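(* Let $\{\varepsilon_n\}_{n\ge1}$ be a sequence of positive numbers tending to $0$, and let $C\{M_n\}$ be a non-quasianalytic Carleman class on $[0,1]$, where $\log M_n$ is an increasing convex sequence with $\lim_{n\to\infty}M_n=+\infty$. Then there exists $f\in\mathrm{Diff}^{\infty}_0([0,1])\cap C\{M_n\}$ such that $E(f)=E_\infty(f)=\{0,1\}$ and $$\Gamma_n(f)\ge \varepsilon_n n^2,\qquad n\ge 1.$$
   Context: $\mathrm{Diff}^{\infty}_0([0,1])$ is the group of all $C^\infty$-smooth diffeomorphisms of $[0,1]$ onto itself fixing the endpoints $0$ and $1$. With $f^n$ the $n$-th iterate of $f$ and $f^{-n}$ the $n$-th iterate of $f^{-1}$, the growth sequence of $f$ is $$\Gamma_n(f)=\max\bigl(\max_{x\in[0,1]}|(f^n)'(x)|,\ \max_{x\in[0,1]}|(f^{-n})'(x)|\bigr),\qquad n\ge1.$$ $E(f)=\{x\in[0,1]:f(x)=x\}$ is the set of fixed points of $f$, and $E_\infty(f)=\{x\in E(f): f'(x)=1,\ f^{(j)}(x)=0\text{ for all }j\ge2\}$. For a sequence of positive numbers $M_n$, the Carleman class is $$C\{M_n\}=\{g\in C^\infty([0,1]): \text{there is a constant } C(g) \text{ with } |g^{(n)}(x)|\le C(g)^nM_n \text{ for all } x\in[0,1],\ n\ge1\},$$ where $g^{(n)}$ is the $n$-th derivative of $g$. The class is non-quasianalytic if for every two closed subintervals $I,J$ of $[0,1]$ with $I\subset\operatorname{Int}J$ there exists $g\in C\{M_n\}$ with $0\le g\le1$,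 $g\equiv1$ on $I$, and $\operatorname{supp}g\subset J$. (By the Denjoy–Carleman theorem this is equivalent to $\sum_{n\ge1}M_n^{-1/n}<\infty$.) *)

(* Defs.v *)
From Stdlib Require Import Reals Lra.
From Coquelicot Require Import Coquelicot.
Open Scope R_scope.

(* A function on [0,1] is represented by a total function R -> R.  Every notion
   below depends only on its values on [0,1]; in particular derivatives are
   taken relative to [0,1], so they are one-sided at 0 and 1. *)
Definition I01 (x : R) : Prop := 0 <= x <= 1.

Definition is_derive01 (f : R -> R) (x l : R) : Prop :=
  D_in f (fun _ => l) I01 x.

Definition ex_derive01 (f : R -> R) (x : R) : Prop :=
  exists l, is_derive01 f x l.

(* [iota] is definite description: the value is meaningful when the described
   object exists and is unique (is_derive01_unique, max01_unique, Gamma_spec). *)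
Definition Derive01 (f : R -> R) (x : R) : R := iota (is_derive01 f x).

Definition Derive01_n (f : R -> R) (n : nat) : R -> R := Nat.iter n Derive01 f.

Definition smooth01 (f : R -> R) : Prop :=
  forall (n : nat) (x : R), I01 x -> ex_derive01 (Derive01_n f n) x.

Record Diff01 : Type := {
  dfun :> R -> R;
  dinv : R -> R;
  dfun_I01 : forall x, I01 x -> I01 (dfun x);
  dinv_I01 : forall x, I01 x -> I01 (dinv x);
  dfunK : forall x, I01 x -> dinv (dfun x) = x;
  dinvK : forall x, I01 x -> dfun (dinv x) = x;
  dfun_smooth : smooth01 dfun;
  dinv_smooth : smooth01 dinv;
  dfun_0 : dfun 0 = 0;
  dfun_1 : dfun 1 = 1
}.

Definition is_max01 (h : R -> R) (m : R) : Prop :=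
  (exists x, I01 x /\ h x = m) /\ (forall x, I01 x -> h x <= m).

Definition max01 (h : R -> R) : R := iota (is_max01 h).

Definition Gamma (f : Diff01) (n : nat) : R :=
  Rmax (max01 (fun x => Rabs (Derive01 (Nat.iter n (dfun f)) x)))
       (max01 (fun x => Rabs (Derive01 (Nat.iter n (dinv f)) x))).

Definition Efix (f : R -> R) (x : R) : Prop := I01 x /\ f x = x.

Definition Efix_inf (f : R -> R) (x : R) : Prop :=
  Efix f x /\ Derive01_n f 1 x = 1 /\
  (forall j : nat, (2 <= j)%nat -> Derive01_n f j x = 0).

(* Sequences indexed by n >= 1 are functions on nat whose value at 0 is never
   used. *)
Definition Carleman (M : nat -> R) (g : R -> R) : Prop :=
  smooth01 g /\
  exists C : R, forall (n : nat) (x : R), (1 <= n)%nat -> I01 x ->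
    Rabs (Derive01_n g n x) <= C ^ n * M n.

Definition supp01 (g : R -> R) : R -> Prop :=
  adherence (fun x => I01 x /\ g x <> 0).

(* The interior of J is taken in R. *)
Definition non_quasianalytic (M : nat -> R) : Prop :=
  forall a b c d : R,
    let I := fun x => a <= x <= b in
    let J := fun x => c <= x <= d in
    a <= b -> c <= d -> included I I01 -> included J I01 ->
    included I (interior J) ->
    exists g : R -> R,
      Carleman M g /\
      (forall x, I01 x -> 0 <= g x <= 1) /\
      (forall x, I x -> g x = 1) /\
      included (supp01 g) J.

Definition log_increasing (M : nat -> R) : Prop :=
  forall n : nat, (1 <= n)%nat -> ln (M n) <= ln (M (S n)).

Definition log_convex (M : nat -> R) : Prop :=
  forall n : nat, (1 <= n)%nat ->
    2 * ln (M (S n)) <= ln (M n) + ln (M (S (S n))).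

Lemma adhDa_I01 (x : R) : I01 x -> adhDa (D_x I01 x) x.
Proof.
unfold I01; intros Hx e He; unfold D_x, Rdist.
destruct (Rle_lt_dec x (1 / 2)) as [H | H].
- exists (x + Rmin (e / 2) (1 / 2)).
  assert (H1 := Rmin_l (e / 2) (1 / 2)); assert (H2 := Rmin_r (e / 2) (1 / 2)).
  assert (0 < Rmin (e / 2) (1 / 2)) by (apply Rmin_pos; lra).
  repeat split; try lra; rewrite Rabs_right; lra.
- exists (x - Rmin (e / 2) (1 / 2)).
  assert (H1 := Rmin_l (e / 2) (1 / 2)); assert (H2 := Rmin_r (e / 2) (1 / 2)).
  assert (0 < Rmin (e / 2) (1 / 2)) by (apply Rmin_pos; lra).
  repeat split; try lra; rewrite Rabs_left; lra.
Qed.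

Lemma is_derive01_unique (f : R -> R) (x l : R) :
  I01 x -> is_derive01 f x l -> Derive01 f x = l.
Proof.
intros Hx H; apply (iota_unique (V := R_CompleteNormedModule)); auto.
intros y Hy; exact (single_limit _ _ _ _ _ (adhDa_I01 x Hx) Hy H).
Qed.

Lemma Derive01_correct (f : R -> R) (x : R) :
  I01 x -> ex_derive01 f x -> is_derive01 f x (Derive01 f x).
Proof.
now intros Hx [l Hl]; rewrite (is_derive01_unique f x l Hx Hl).
Qed.

Lemma max01_unique (h : R -> R) (m : R) : is_max01 h m -> max01 h = m.
Proof.
intros [[x [Hx Ex]] Hm]; apply (iota_unique (V := R_CompleteNormedModule)); [|split; eauto].
intros y [[z [Hz Ez]] Hy]; apply Rle_antisym.
- now rewrite <- Ez; apply Hm.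
- now rewrite <- Ex; apply Hy.
Qed.

Definition clamp (x : R) : R := Rmax 0 (Rmin x 1).

Lemma clamp_I01 (x : R) : I01 (clamp x).
Proof.
unfold I01, clamp, Rmax, Rmin.
destruct (Rle_dec x 1); destruct (Rle_dec 0 _); lra.
Qed.

Lemma clamp_id (x : R) : I01 x -> clamp x = x.
Proof.
unfold I01, clamp, Rmax, Rmin; intros H.
destruct (Rle_dec x 1); destruct (Rle_dec 0 _); lra.
Qed.

Lemma clamp_lip (x y : R) : Rabs (clamp x - clamp y) <= Rabs (x - y).
Proof.
unfold clamp, Rmax, Rmin.
destruct (Rle_dec x 1); destruct (Rle_dec y 1);
  repeat (destruct (Rle_dec 0 _)); unfold Rabs;
  repeat (destruct (Rcase_abs _)); lra.
Qed.

Lemma max01_spec (h : R -> R) :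
  (forall x, I01 x -> continue_in h I01 x) -> is_max01 h (max01 h).
Proof.
intros Hc.
destruct (continuity_ab_maj (fun x => h (clamp x)) 0 1) as [m [Hm Im]]; [lra| |].
- intros c Ic e He.
  destruct (Hc c Ic e He) as [d [Hd H]].
  exists d; split; [exact Hd|].
  intros y [_ Hy]; simpl in *; unfold Rdist in *.
  rewrite (clamp_id c Ic).
  destruct (Req_dec (clamp y) c) as [E | E].
  + now rewrite E, Rminus_diag, Rabs_R0.
  + apply H; split; [split; [apply clamp_I01 | now auto]|].
    apply Rle_lt_trans with (2 := Hy).
    rewrite <- (clamp_id c Ic) at 1; apply clamp_lip.
- assert (H : is_max01 h (h m)).
  { split; [now exists m|].
    intros x Hx; specialize (Hm x Hx).
    now rewrite (clamp_id x Hx), (clamp_id m Im) in Hm. }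
  now rewrite (max01_unique _ _ H).
Qed.

Definition C1_self (f : R -> R) : Prop :=
  (forall x, I01 x -> I01 (f x)) /\
  forall x, I01 x -> ex_derive01 f x /\ continue_in (Derive01 f) I01 x.

Lemma continue_in_comp (f g : R -> R) (x : R) :
  (forall y, I01 y -> I01 (f y)) ->
  continue_in f I01 x -> continue_in g I01 (f x) ->
  continue_in (fun y => g (f y)) I01 x.
Proof.
intros Hf Cf Cg e He.
destruct (Cg e He) as [d [Hd H]]; destruct (Cf d Hd) as [d' [Hd' H']].
exists d'; split; [exact Hd'|]; intros y [[Iy Ny] Hy].
destruct (Req_dec (f y) (f x)) as [E | E].
- simpl; rewrite E; unfold Rdist; now rewrite Rminus_diag, Rabs_R0.
- apply H; split; [split; auto|]; apply H'; split; [split|]; auto.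
Qed.

Lemma continue_in_ext (f g : R -> R) (x : R) :
  I01 x -> (forall y, I01 y -> f y = g y) ->
  continue_in f I01 x -> continue_in g I01 x.
Proof.
intros Hx E Cf e He; destruct (Cf e He) as [d [Hd H]].
exists d; split; [exact Hd|]; intros y [[Iy Ny] Hy].
rewrite <- (E y Iy), <- (E x Hx); apply H; repeat split; auto; apply Iy.
Qed.

Lemma is_derive01_comp (f g : R -> R) (x l m : R) :
  (forall y, I01 y -> I01 (f y)) ->
  is_derive01 f x l -> is_derive01 g (f x) m ->
  is_derive01 (fun y => g (f y)) x (l * m).
Proof.
intros Hf Df Dg e He.
destruct (Dcomp I01 I01 _ _ f g x Df Dg e He) as [d [Hd H]].
exists d; split; [exact Hd|]; intros y [[Iy Ny] Hy].
apply H; split; [split; [split|]|]; auto.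
Qed.

Lemma C1_self_iter (f : R -> R) (n : nat) : C1_self f -> C1_self (Nat.iter n f).
Proof.
intros [Hf Sf]; induction n as [|n [Hn Sn]].
- split; [now auto|]; intros x Hx.
  assert (D1 : forall y, I01 y -> is_derive01 (Nat.iter 0 f) y 1).
  { intros y _; exact (Dx I01 y). }
  split; [exists 1; auto|].
  apply (continue_in_ext (fun _ => 1)); auto.
  + now intros y Hy; rewrite (is_derive01_unique _ y 1 Hy (D1 y Hy)).
  + intros e He; exists 1; split; [lra|]; intros y _; simpl.
    unfold Rdist; now rewrite Rminus_diag, Rabs_R0.
- set (h := Nat.iter n f) in *.
  change (C1_self (fun y => f (h y))).
  split; [now auto|]; intros x Hx.
  assert (D : forall y, I01 y ->
    is_derive01 (fun y => f (h y)) y (Derive01 h y * Derive01 f (h y))).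
  { intros y Hy; apply is_derive01_comp; auto; apply Derive01_correct; auto.
    - now apply Sn.
    - now apply Sf; auto. }
  split; [eexists; apply (D x Hx)|].
  apply (continue_in_ext (fun y => Derive01 h y * Derive01 f (h y))); auto.
  + intros y Hy; symmetry; apply is_derive01_unique; auto.
  + destruct (Sn x Hx) as [Ex Cx].
    apply limit_mul; [exact Cx|].
    apply continue_in_comp; auto.
    * now apply (cont_deriv h (fun _ => Derive01 h x)), Derive01_correct.
    * now apply Sf; auto.
Qed.

Lemma C1_self_smooth (f : R -> R) :
  (forall x, I01 x -> I01 (f x)) -> smooth01 f -> C1_self f.
Proof.
intros Hf Sf; split; [exact Hf|]; intros x Hx; split; [exact (Sf 0%nat x Hx)|].
destruct (Sf 1%nat x Hx) as [l Hl]; exact (cont_deriv _ _ _ _ Hl).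
Qed.

Lemma max01_Derive01_iter (f : R -> R) (n : nat) :
  (forall x, I01 x -> I01 (f x)) -> smooth01 f ->
  let h := fun x => Rabs (Derive01 (Nat.iter n f) x) in is_max01 h (max01 h).
Proof.
intros Hf Sf h; apply max01_spec; intros x Hx.
destruct (C1_self_iter f n (C1_self_smooth f Hf Sf)) as [_ H].
intros e He; destruct (H x Hx) as [_ C]; destruct (C e He) as [d [Hd K]].
exists d; split; [exact Hd|]; intros y Hy.
apply Rle_lt_trans with (2 := K y Hy).
apply Rabs_triang_inv2.
Qed.

Lemma Gamma_spec (f : Diff01) (n : nat) :
  exists a b : R,
    is_max01 (fun x => Rabs (Derive01 (Nat.iter n (dfun f)) x)) a /\
    is_max01 (fun x => Rabs (Derive01 (Nat.iter n (dinv f)) x)) b /\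
    Gamma f n = Rmax a b.
Proof.
eexists; eexists; split; [|split; [|reflexivity]].
- apply max01_Derive01_iter; [apply dfun_I01 | apply dfun_smooth].
- apply max01_Derive01_iter; [apply dinv_I01 | apply dinv_smooth].
Qed.

(* Main.v *)
Require Import Defs.
From Stdlib Require Import Reals Lra Lia Classical IndefiniteDescription.
From Coquelicot Require Import Coquelicot.
Open Scope R_scope.

(** Put [f x = x + r v(x)] with [v > 0] on (0,1) and flat at both ends.  By the
    mean value theorem on [[x, f x]], [Gamma_n(f) >= v(f^n x) / v(x)].  If
    [c (x - m)^2 <= r v <= K (x - m)^2 + d] to the right of [m], then as long as
    [d n^2] is small some [x] within O(1/n) of [m] reaches a fixed point [z > m]
    in exactly [n] steps, whence [Gamma_n(f) >= a n^2] with [a] depending on [c],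
    [K] and [z - m] but not on [d].  Take such wells at [m_k -> 0]: their
    constants [a_k] fix times [N_k] after which [eps_n <= a_k], and only then are
    the depths chosen so small that the [k]-th well works up to time [N_(k+1)].
    For [n < N_0] one uses that [f' > 0] can be made arbitrarily small at the
    minimum of [v'] by letting [r] approach [1 / max (-v')], without affecting
    the wells.

    All summands of [v] are in the class with one and the same geometric
    constant: they are products of reflected translates of a single function [G]
    (zero on the left of 0, positive on the right), which is a translated
    primitive of a bump of the class, and log-convexity makes the class closed
    under products. *)

(** * Jets: a smooth function together with its derivatives *)

Definition jet (F : nat -> R -> R) : Prop :=
  forall n x, is_derive (F n) x (F (S n) x).

(** A quadratic error bound survives summation of a series and passage to an inverse function, so
    both of those differentiations reduce to this test. *)
Lemma quadratic_error_is_derive (f : R -> R) (x l B : R) :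
  (forall y, Rabs (f y - f x - l * (y - x)) <= B * (y - x) ^ 2) ->
  is_derive f x l.
Proof.
intros H; apply is_derive_Reals; intros e He.
assert (HB : 0 < Rabs B + 1) by (generalize (Rabs_pos B); lra).
assert (Hd : 0 < e / (Rabs B + 1)) by (apply Rdiv_lt_0_compat; lra).
exists (mkposreal _ Hd); simpl; intros h Hh Lh.
replace ((f (x + h) - f x) / h - l) with ((f (x + h) - f x - l * h) / h) by (field; auto).
specialize (H (x + h)); replace (x + h - x) with h in H by ring.
assert (Ph : 0 < Rabs h) by now apply Rabs_pos_lt.
unfold Rdiv; rewrite Rabs_mult, Rabs_inv.
apply Rmult_lt_reg_r with (Rabs h); [exact Ph|].
rewrite Rmult_assoc, Rinv_l, Rmult_1_r by lra.
apply Rle_lt_trans with (1 := H).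
replace (h ^ 2) with (Rabs h * Rabs h) by (rewrite <- Rabs_mult; rewrite Rabs_right; [ring|]; nra).
rewrite <- Rmult_assoc; apply Rmult_lt_compat_r; [exact Ph|].
apply Rle_lt_trans with ((Rabs B) * Rabs h).
- apply Rmult_le_compat_r; [lra|apply Rle_abs].
- apply Rlt_le_trans with ((Rabs B + 1) * Rabs h); [nra|].
  apply Rlt_le; apply Rmult_lt_compat_l with (r := Rabs B + 1) in Lh; [|lra].
  replace e with ((Rabs B + 1) * (e / (Rabs B + 1))) by (field; lra); exact Lh.
Qed.

Lemma derive_mvt (f df : R -> R) (x y : R) :
  (forall t, is_derive f t (df t)) ->
  exists c, Rmin x y <= c <= Rmax x y /\ f y - f x = df c * (y - x).
Proof.
intros H; destruct (MVT_gen f x y df) as [c Hc]; eauto.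
intros t _; apply continuity_pt_filterlim, (ex_derive_continuous (K := R_AbsRing) (V := R_NormedModule)).
exists (df t); apply H.
Qed.

Lemma between_dist (x y c : R) :
  Rmin x y <= c <= Rmax x y -> Rabs (c - x) <= Rabs (y - x).
Proof.
unfold Rmin, Rmax, Rabs; destruct (Rle_dec x y);
  repeat (destruct (Rcase_abs _)); lra.
Qed.

(** Two applications of the mean value theorem; the intermediate point satisfies
    [|c - x| <= |y - x|], and the factor 1/2 of the sharp bound is given up. *)
Lemma jet_taylor (F : nat -> R -> R) (n : nat) (B x y : R) :
  jet F -> (forall t, Rabs (F (S (S n)) t) <= B) ->
  Rabs (F n y - F n x - F (S n) x * (y - x)) <= B * (y - x) ^ 2.
Proof.
intros J H.
destruct (derive_mvt _ _ x y (J n)) as [c [Hc ->]].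
destruct (derive_mvt _ _ x c (J (S n))) as [e [_ E]].
replace (F (S n) c * (y - x) - F (S n) x * (y - x))
  with (F (S (S n)) e * ((c - x) * (y - x))) by (rewrite <- Rmult_assoc, <- E; ring).
apply between_dist in Hc.
rewrite !Rabs_mult, <- (pow2_abs (y - x)).
specialize (H e); assert (P := Rabs_pos (F (S (S n)) e)).
assert (P1 := Rabs_pos (c - x)); assert (P2 := Rabs_pos (y - x)).
apply Rmult_le_compat; auto; [|simpl]; nra.
Qed.

(** * Geometrically weighted series of jets *)

Lemma ex_series_half (u : nat -> R) (B : R) :
  (forall k, Rabs (u k) <= B) -> ex_series (fun k => (/ 2) ^ k * u k).
Proof.
intros H; apply (ex_series_le (K := R_AbsRing) (V := R_CompleteNormedModule) _ (fun k => B * (/ 2) ^ k)).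
- intros k; change (Rabs ((/ 2) ^ k * u k) <= B * (/ 2) ^ k).
  rewrite Rabs_mult, (Rabs_right ((/ 2) ^ k)), Rmult_comm by (apply Rle_ge, pow_le; lra).
  apply Rmult_le_compat_r; [apply pow_le; lra|apply H].
- apply (ex_series_scal (K := R_AbsRing) (V := R_NormedModule) B), ex_series_geom; rewrite Rabs_right; lra.
Qed.

Lemma Series_half_bound (u : nat -> R) (B : R) :
  (forall k, Rabs (u k) <= B) -> Rabs (Series (fun k => (/ 2) ^ k * u k)) <= 2 * B.
Proof.
intros H.
assert (E : forall k, Rabs ((/ 2) ^ k * u k) = (/ 2) ^ k * Rabs (u k)).
{ intros k; rewrite Rabs_mult, (Rabs_right ((/ 2) ^ k)); auto; apply Rle_ge, pow_le; lra. }
assert (X : ex_series (fun k => Rabs ((/ 2) ^ k * u k))).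
{ apply ex_series_ext with (2 := ex_series_half (fun k => Rabs (u k)) B
    (fun k => eq_ind_r (fun t => t <= B) (H k) (Rabs_Rabsolu (u k)))).
  intros k; now rewrite E. }
apply Rle_trans with (1 := Series_Rabs _ X).
apply Rle_trans with (Series (fun k => (/ 2) ^ k * B)).
- apply Series_le.
  + intros k; split; [apply Rabs_pos|]; rewrite E.
    apply Rmult_le_compat_l; [apply pow_le; lra|apply H].
  + apply ex_series_half with (Rabs B); intros; lra.
- rewrite Series_scal_r, Series_geom by (rewrite Rabs_right; lra); right; field.
Qed.

Definition jseries (U : nat -> nat -> R -> R) (n : nat) (x : R) : R :=
  Series (fun k => (/ 2) ^ k * U k n x).

(** The first-order errors of all terms share the bound [B (n+2) (y - x)^2], and the weights have
    sum 2, so the sum again has a quadratic error. *)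
Lemma jet_series (U : nat -> nat -> R -> R) (B : nat -> R) :
  (forall k, jet (U k)) -> (forall k n x, Rabs (U k n x) <= B n) ->
  jet (jseries U).
Proof.
intros J H n x; apply quadratic_error_is_derive with (2 * B (S (S n))); intros y.
set (w := fun k => U k n y - U k n x - U k (S n) x * (y - x)).
assert (X := fun n x => ex_series_half (fun k => U k n x) (B n) (fun k => H k n x)).
replace (_ - _ - _) with (Series (fun k => (/ 2) ^ k * w k)).
- rewrite Rmult_assoc; apply Series_half_bound; intros k.
  apply jet_taylor; auto.
- unfold jseries; rewrite <- Series_scal_r, <- !Series_minus.
  1: apply Series_ext; intros k; unfold w; ring.
  all: try apply X.
  all: try apply (ex_series_minus (K := R_AbsRing) (V := R_NormedModule)); try apply X.
  all: apply ex_series_scal_r, X.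
Qed.

(** * Products, affine substitution and flat points of jets *)

Definition jshift (F : nat -> R -> R) (n : nat) : R -> R := F (S n).

(* The Leibniz rule unfolded: (FG)^(n+1) = (F'G)^(n) + (FG')^(n). *)
Fixpoint jmul (F G : nat -> R -> R) (n : nat) (x : R) : R :=
  match n with
  | O => F O x * G O x
  | S n => jmul (jshift F) G n x + jmul F (jshift G) n x
  end.

Lemma jet_mul (F G : nat -> R -> R) : jet F -> jet G -> jet (jmul F G).
Proof.
intros JF JG n x; revert F G JF JG; induction n as [|n IH]; intros F G JF JG.
- apply (is_derive_mult (F 0%nat) (G 0%nat) x); [apply JF|apply JG|apply Rmult_comm].
- apply (is_derive_plus (jmul (jshift F) G n) (jmul F (jshift G) n) x);
    apply IH; auto; intros k y; unfold jshift; auto.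
Qed.

(* The index shifts [i], [j] make the induction on [n] go through. *)
Lemma jmul_bound_shift (W : nat -> R) (K : R) (i j : nat) (F G : nat -> R -> R)
  (A C A' C' x : R) (n : nat) :
  0 <= A -> 0 <= C -> 0 <= A' -> 0 <= C' ->
  (forall i j, W i * W j <= K * W (i + j)%nat) ->
  (forall k, Rabs (F k x) <= A * C ^ k * W (i + k)%nat) ->
  (forall k, Rabs (G k x) <= A' * C' ^ k * W (j + k)%nat) ->
  Rabs (jmul F G n x) <= K * A * A' * (C + C') ^ n * W (i + j + n)%nat.
Proof.
intros HA HC HA' HC' HW; revert i j F G A A' HA HA'.
induction n as [|n IH]; intros i j F G A A' HA HA' HF HG; simpl.
- specialize (HF 0%nat); specialize (HG 0%nat); simpl in *.
  rewrite Rabs_mult, !Nat.add_0_r in *.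
  specialize (HW i j).
  apply Rle_trans with (A * A' * (W i * W j)).
  + apply Rle_trans with (A * 1 * W i * (A' * 1 * W j)); [|right; ring].
    apply Rmult_le_compat; auto using Rabs_pos.
  + apply Rle_trans with (A * A' * (K * W (i + j)%nat)); [|right; ring].
    apply Rmult_le_compat_l; auto; nra.
- apply Rle_trans with (1 := Rabs_triang _ _).
  apply Rle_trans with
    (K * (A * C) * A' * (C + C') ^ n * W (S i + j + n)%nat +
     K * A * (A' * C') * (C + C') ^ n * W (i + S j + n)%nat).
  + apply Rplus_le_compat; apply IH; auto; try nra;
      intros k; unfold jshift; [specialize (HF (S k))|specialize (HG (S k))];
      simpl in *; rewrite Nat.add_succ_r in *; [apply Rle_trans with (1 := HF)|apply Rle_trans with (1 := HG)]; right; simpl; ring.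
  + replace (S i + j + n)%nat with (i + j + S n)%nat by lia.
    replace (i + S j + n)%nat with (i + j + S n)%nat by lia.
    right; ring.
Qed.

Lemma jet_affine (F : nat -> R -> R) (s b : R) :
  jet F -> jet (fun n x => s ^ n * F n (s * x + b)).
Proof.
intros J n x; simpl.
replace (s * s ^ n * F (S n) (s * x + b)) with (s ^ n * (s * F (S n) (s * x + b))) by ring.
apply is_derive_scal.
apply (is_derive_comp (F n) (fun t => s * t + b)); [apply J|].
auto_derive; [auto|ring].
Qed.

(** Where [F O] vanishes locally, so does every derivative; continuity of [F n] carries the zero to
    a limit of such points. *)
Lemma jet_vanish (F : nat -> R -> R) (n : nat) (x : R) :
  jet F ->
  (forall e, 0 < e -> exists y, Rabs (y - x) < e /\ locally y (fun t => F O t = 0)) ->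
  F n x = 0.
Proof.
intros J H.
assert (Z : forall y, locally y (fun t => F O t = 0) -> locally y (fun t => F n t = 0)).
{ induction n as [|n IH]; auto; intros y Hy.
  apply filter_imp with (2 := locally_locally _ _ (IH y Hy)).
  intros t Ht; rewrite <- (is_derive_unique _ _ _ (J n t)).
  apply is_derive_unique, is_derive_ext_loc with (f := fun _ => 0).
  - apply filter_imp with (2 := Ht); auto.
  - apply (is_derive_const (K := R_AbsRing) (V := R_NormedModule)). }
destruct (Req_dec (F n x) 0) as [E|E]; auto; exfalso.
assert (Cx : continuity_pt (F n) x).
{ apply continuity_pt_filterlim, (ex_derive_continuous (K := R_AbsRing) (V := R_NormedModule)).
  eexists; apply J. }
destruct (Cx (Rabs (F n x)) (Rabs_pos_lt _ E)) as [d [Hd K]].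
destruct (H d Hd) as [y [Hy Ly]].
apply Z, locally_singleton in Ly.
destruct (Req_dec y x) as [->|N]; [lra|].
specialize (K y); simpl in K; unfold Rdist in K; rewrite Ly in K.
rewrite Rminus_0_l, Rabs_Ropp in K.
enough (Rabs (F n x) < Rabs (F n x)) by lra; apply K; repeat split; auto.
Qed.

(** * Derivatives on [0,1] and the Carleman bounds *)

Lemma is_derive_is_derive01 (f : R -> R) (x l : R) :
  is_derive f x l -> is_derive01 f x l.
Proof.
intros H; apply is_derive_Reals in H; intros e He.
destruct (H e He) as [d Hd]; exists d; split; [apply cond_pos|].
intros y [[_ Ny] Hy]; simpl in *; unfold Rdist in *.
specialize (Hd (y - x)); replace (x + (y - x)) with y in Hd by ring.
apply Hd; auto; lra.
Qed.

Lemma is_derive01_interior (f : R -> R) (x l : R) :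
  0 < x < 1 -> is_derive01 f x l -> is_derive f x l.
Proof.
intros Hx H; apply is_derive_Reals; intros e He.
destruct (H e He) as [d [Hd K]].
assert (P : 0 < Rmin d (Rmin x (1 - x))) by (repeat apply Rmin_pos; lra).
exists (mkposreal _ P); simpl; intros h Nh Lh.
assert (L1 : Rabs h < d) by (apply Rlt_le_trans with (1 := Lh), Rmin_l).
assert (L2 : Rabs h < Rmin x (1 - x)) by (apply Rlt_le_trans with (1 := Lh), Rmin_r).
assert (L3 := Rmin_l x (1 - x)); assert (L4 := Rmin_r x (1 - x)).
assert (L5 := Rle_abs h); assert (L6 := Rle_abs (- h)); rewrite Rabs_Ropp in L6.
specialize (K (x + h)); simpl in K; unfold Rdist in K.
replace (x + h - x) with h in K by ring.
apply K; unfold D_x, I01; repeat split; auto; lra.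
Qed.

Lemma is_derive01_ext_loc (f g : R -> R) (x l d : R) :
  0 < d -> I01 x -> (forall y, I01 y -> Rabs (y - x) < d -> f y = g y) ->
  is_derive01 f x l -> is_derive01 g x l.
Proof.
intros Pd Hx E H e He.
destruct (H e He) as [d' [Hd' K]].
exists (Rmin d d'); split; [now apply Rmin_pos|].
intros y [[Iy Ny] Hy]; simpl in *; unfold Rdist in *.
assert (M1 := Rmin_l d d'); assert (M2 := Rmin_r d d').
rewrite <- (E y), <- (E x); auto; try (rewrite Rminus_diag, Rabs_R0); try lra.
apply K; split; [split; auto|]; simpl; unfold Rdist; lra.
Qed.

Lemma jet_Derive01_n (F : nat -> R -> R) (f : R -> R) (n : nat) (x : R) :
  jet F -> (forall y, I01 y -> f y = F O y) -> I01 x -> Derive01_n f n x = F n x.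
Proof.
intros J E; revert x; induction n as [|n IH]; intros x Hx; [now apply E|].
apply is_derive01_unique; auto.
apply is_derive01_ext_loc with (f := F n) (d := 1); auto; [lra| |].
- intros; symmetry; auto.
- apply is_derive_is_derive01, J.
Qed.

Lemma jet_smooth01 (F : nat -> R -> R) (f : R -> R) :
  jet F -> (forall y, I01 y -> f y = F O y) -> smooth01 f.
Proof.
intros J E n x Hx; exists (F (S n) x).
apply is_derive01_ext_loc with (f := F n) (d := 1); auto; [lra| |].
- intros; symmetry; eapply jet_Derive01_n; eauto.
- apply is_derive_is_derive01, J.
Qed.

(** Extension by zero turns the one-sided derivatives of a bump on [0,1] into a jet on the whole
    line. *)
Definition extend0 (g : R -> R) (n : nat) (x : R) : R :=
  if Rle_dec 0 x then if Rle_dec x 1 then Derive01_n g n x else 0 else 0.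

Lemma extend0_in (g : R -> R) (n : nat) (x : R) :
  I01 x -> extend0 g n x = Derive01_n g n x.
Proof.
unfold I01, extend0; intros H.
destruct (Rle_dec 0 x); [destruct (Rle_dec x 1)|]; auto; lra.
Qed.

Lemma extend0_out (g : R -> R) (a b : R) (n : nat) (x : R) :
  (forall x, I01 x -> ~ a <= x <= b -> g x = 0) -> ~ a <= x <= b ->
  extend0 g n x = 0.
Proof.
intros Z Hx; unfold extend0.
destruct (Rle_dec 0 x) as [H0|]; auto; destruct (Rle_dec x 1) as [H1|]; auto.
assert (Ix : I01 x) by now split.
clear H0 H1; revert x Hx Ix; induction n as [|n IH]; intros x Hx Ix; [now apply Z|].
apply is_derive01_unique; auto.
assert (Hd : exists d, 0 < d /\ forall y, Rabs (y - x) < d -> ~ a <= y <= b).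
{ destruct (Rlt_dec x a).
  - exists (a - x); split; [lra|]; intros y Hy; apply Rabs_def2 in Hy; lra.
  - exists (x - b); split; [lra|]; intros y Hy; apply Rabs_def2 in Hy; lra. }
destruct Hd as [d [Pd Hd]].
apply is_derive01_ext_loc with (f := fun _ => 0) (d := d); auto.
- intros y Iy Hy; symmetry; apply IH; auto.
- apply Dconst.
Qed.

(** Points of [[a, b]] are interior to [0,1], where relative and ordinary derivatives agree; the
    complement of [[a, b]] is open and the extension is zero there. *)
Lemma extend0_jet (g : R -> R) (a b : R) :
  0 < a -> b < 1 -> smooth01 g ->
  (forall x, I01 x -> ~ a <= x <= b -> g x = 0) -> jet (extend0 g).
Proof.
intros Ha Hb Sg Z n x.
destruct (classic (a <= x <= b)) as [H|H].
- assert (Ix : I01 x) by (unfold I01; lra).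
  rewrite (extend0_in g (S n) x Ix).
  apply is_derive01_interior; [lra|].
  apply is_derive01_ext_loc with (f := Derive01_n g n) (d := 1); auto; [lra| |].
  + intros y Iy _; symmetry; now apply extend0_in.
  + apply Derive01_correct; auto; apply Sg; auto.
- rewrite (extend0_out g a b (S n) x Z H).
  assert (Hd : exists d : posreal, forall y, Rabs (y - x) < d -> ~ a <= y <= b).
  { destruct (Rlt_dec x a).
    - assert (P : 0 < a - x) by lra.
      exists (mkposreal _ P); intros y Hy; apply Rabs_def2 in Hy; simpl in Hy; lra.
    - assert (P : 0 < x - b) by lra.
      exists (mkposreal _ P); intros y Hy; apply Rabs_def2 in Hy; simpl in Hy; lra. }
  destruct Hd as [d Hd].
  apply is_derive_ext_loc with (f := fun _ => 0).
  + exists d; intros y Hy; symmetry; apply extend0_out with a b; auto.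
  + apply (is_derive_const (K := R_AbsRing) (V := R_NormedModule)).
Qed.

(** * Carleman weights and closure under products *)

(* [M 0] is unconstrained in the theorem; this choice makes the weights
   nondecreasing from index 0. *)
Definition weight (M : nat -> R) (n : nat) : R := M (Nat.max 1 n).

Lemma weight_pos (M : nat -> R) (n : nat) :
  (forall n, (1 <= n)%nat -> 0 < M n) -> 0 < weight M n.
Proof. intros H; apply H; lia. Qed.

Lemma weight_le (M : nat -> R) (n : nat) :
  (forall n, (1 <= n)%nat -> 0 < M n) -> log_increasing M ->
  weight M n <= weight M (S n).
Proof.
intros P H; unfold weight.
destruct n as [|n]; [apply Rle_refl|].
replace (Nat.max 1 (S n)) with (S n) by lia.
replace (Nat.max 1 (S (S n))) with (S (S n)) by lia.
destruct (Rle_lt_dec (M (S n)) (M (S (S n)))) as [L|L]; auto.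
apply ln_increasing in L; [|apply P; lia].
specialize (H (S n) ltac:(lia)); lra.
Qed.

Lemma weight_mono (M : nat -> R) (m n : nat) :
  (forall n, (1 <= n)%nat -> 0 < M n) -> log_increasing M ->
  (m <= n)%nat -> weight M m <= weight M n.
Proof.
intros P H L; induction L; [lra|].
apply Rle_trans with (1 := IHL), weight_le; auto.
Qed.

(** Convexity makes the increments [d] of [ln M] nondecreasing; each induction step compares the
    increment at [i] with the one at [i + j]. *)
Lemma log_convex_superadditive (M : nat -> R) (i j : nat) :
  log_convex M ->
  ln (M (S i)) + ln (M (S j)) <= ln (M 1%nat) + ln (M (S (i + j))).
Proof.
intros Hc.
set (d := fun n => ln (M (S (S n))) - ln (M (S n))).
assert (Hd : forall k n, d n <= d (n + k)%nat).
{ induction k as [|k IH]; intros n; [rewrite Nat.add_0_r; lra|].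
  apply Rle_trans with (1 := IH n); rewrite Nat.add_succ_r; unfold d.
  specialize (Hc (S (n + k)) ltac:(lia)); lra. }
induction i as [|i IH]; simpl; [lra|].
specialize (Hd j i); unfold d in Hd; lra.
Qed.

(** For positive indices, log-convexity bounds the product by [M 1] times the weight at index
    [i + j - 1], and monotonicity gives away the last unit. *)
Lemma weight_mul (M : nat -> R) (i j : nat) :
  (forall n, (1 <= n)%nat -> 0 < M n) -> log_increasing M -> log_convex M ->
  weight M i * weight M j <= M 1%nat * weight M (i + j).
Proof.
intros P Hi Hc.
destruct i as [|i]; [right; reflexivity|].
destruct j as [|j]; [rewrite Nat.add_0_r; right; apply Rmult_comm|].
apply Rle_trans with (M 1%nat * M (S (i + j))).
- change (M (S i) * M (S j) <= M 1%nat * M (S (i + j))).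
  assert (S1 := log_convex_superadditive M i j Hc).
  rewrite <- !ln_mult in S1 by (apply P; lia).
  destruct (Rle_lt_dec (M (S i) * M (S j)) (M 1%nat * M (S (i + j)))) as [L|L]; auto.
  apply ln_increasing in L; [lra|].
  apply Rmult_lt_0_compat; apply P; lia.
- apply Rmult_le_compat_l; [apply Rlt_le, P; lia|].
  change (M (S (i + j))) with (weight M (S (i + j))).
  apply weight_mono; auto; lia.
Qed.

(** The factor [A] is kept apart from the geometric constant [c] because summing functions with a
    common [c] changes [A] only. Order 0 is included, as products require. *)
Definition carleman_bound (M : nat -> R) (D : R -> Prop) (A c : R) (F : nat -> R -> R) : Prop :=
  forall n x, D x -> Rabs (F n x) <= A * c ^ n * weight M n.

Lemma carleman_bound_mul (M : nat -> R) (D : R -> Prop) (A c A' c' : R) (F G : nat -> R -> R) :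
  (forall n, (1 <= n)%nat -> 0 < M n) -> log_increasing M -> log_convex M ->
  0 <= A -> 0 <= c -> 0 <= A' -> 0 <= c' ->
  carleman_bound M D A c F -> carleman_bound M D A' c' G ->
  carleman_bound M D (M 1%nat * A * A') (c + c') (jmul F G).
Proof.
intros P Hi Hc HA HC HA' HC' HF HG n x Hx.
apply (jmul_bound_shift (weight M) (M 1%nat) 0 0); auto.
intros i j; now apply weight_mul.
Qed.

Lemma is_derive_nondecreasing (f df : R -> R) (x y : R) :
  (forall t, is_derive f t (df t)) -> (forall t, 0 <= df t) -> x <= y -> f x <= f y.
Proof.
intros H P L; destruct (derive_mvt f df x y H) as [c [_ E]].
specialize (P c); nra.
Qed.

Lemma jet_primitive (F : nat -> R -> R) (a : R) :
  jet F -> jet (fun n x => match n with O => RInt (F O) a x | S n => F n x end).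
Proof.
intros J [|n] x; [|apply J].
assert (K : forall t, continuous (F O) t).
{ intros t; apply (ex_derive_continuous (K := R_AbsRing) (V := R_NormedModule)); eexists; apply J. }
apply is_derive_RInt with (a := a); auto.
apply filter_forall; intros b; apply (RInt_correct (V := R_CompleteNormedModule)).
apply (ex_RInt_continuous (V := R_CompleteNormedModule)); auto.
Qed.

(** The support stays away from 0 and 1, so that the bump extends by zero. *)
Lemma nqa_bump (M : nat -> R) :
  (forall n, (1 <= n)%nat -> 0 < M n) ->
  non_quasianalytic M ->
  exists g C, smooth01 g /\ 1 <= C /\
    (forall n x, (1 <= n)%nat -> I01 x -> Rabs (Derive01_n g n x) <= C ^ n * M n) /\
    (forall x, I01 x -> 0 <= g x <= 1) /\
    (forall x, 3/8 <= x <= 5/8 -> g x = 1) /\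
    (forall x, I01 x -> ~ 1/4 <= x <= 3/4 -> g x = 0).
Proof.
intros P H; destruct (H (3/8) (5/8) (1/4) (3/4)) as [g [[Sg [C HC]] [B [E S]]]]; try lra.
- intros x Hx; unfold I01; lra.
- intros x Hx; unfold I01; lra.
- intros x Hx; assert (P8 : 0 < 1/8) by lra.
  exists (mkposreal _ P8); intros y Hy; unfold disc in Hy; simpl in Hy.
  apply Rabs_def2 in Hy; lra.
- exists g, (Rmax 1 (Rabs C)); repeat split; auto using Rmax_l; try (now apply B).
  + intros n x Hn Hx; apply Rle_trans with (1 := HC n x Hn Hx).
    assert (0 < M n) by auto.
    apply Rmult_le_compat_r; [lra|].
    apply Rle_trans with (Rabs (C ^ n)); [apply Rle_abs|].
    rewrite <- RPow_abs; apply pow_incr; split; [apply Rabs_pos|apply Rmax_r].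
  + intros x Ix Nx; destruct (Req_dec (g x) 0) as [|N]; auto; exfalso.
    apply Nx, S, adherence_P1; now split.
Qed.

(** * A flat function of the class and the wells *)

(** The primitive of a nonnegative bump is nondecreasing; translated so that its last zero sits at
    0, it is positive on the right. Integration shifts derivative orders by one, which increasing
    weights absorb. *)
Lemma flat_function (M : nat -> R) :
  (forall n, (1 <= n)%nat -> 0 < M n) -> log_increasing M -> non_quasianalytic M ->
  exists G A c, jet G /\ 0 <= A /\ 1 <= c /\
    carleman_bound M (fun x => -1 <= x <= 1) A c G /\
    (forall x, x <= 0 -> G O x = 0) /\
    (forall x, 0 < x -> 0 < G O x) /\
    (forall x y, x <= y -> G O x <= G O y).
Proof.
intros P Hi H.
destruct (nqa_bump M P H) as [g [C [Sg [HC [Bg [Rg [E1 E0]]]]]]].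
assert (Jg : jet (extend0 g)) by (apply extend0_jet with (1/4) (3/4); auto; lra).
assert (JP := jet_primitive (extend0 g) 0 Jg).
set (P0 := fun (n : nat) (x : R) => match n return R with O => RInt (V := R_CompleteNormedModule) (extend0 g 0) 0 x | S n => extend0 g n x end).
change (jet P0) in JP.
assert (Rg' : forall x, 0 <= extend0 g 0 x <= 1).
{ intros x; destruct (classic (I01 x)) as [Ix|N].
  - rewrite extend0_in by auto; now apply Rg.
  - rewrite (extend0_out g (1/4) (3/4)); auto; [lra|]; unfold I01 in N; lra. }
assert (Z0 : P0 O 0 = 0) by apply (RInt_point (V := R_CompleteNormedModule)).
assert (Mono : forall x y, x <= y -> P0 O x <= P0 O y).
{ intros x y; apply is_derive_nondecreasing with (df := P0 1%nat); [apply (JP O)|apply Rg']. }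
(* The bump vanishes left of 1/4, hence so does its primitive from 0; continuity gives the value at
   1/4. *)
assert (Zl : P0 O (1/4) = 0).
{ destruct (derive_mvt (P0 O) (P0 1%nat) 0 (1/8) (JP O)) as [t [Ht E]].
  rewrite Rmin_left, Rmax_right in Ht by lra.
  assert (Zt : forall x, x < 1/4 -> P0 O x = 0).
  { intros x Hx; destruct (derive_mvt (P0 O) (P0 1%nat) 0 x (JP O)) as [s [Hs Es]].
    assert (s < 1/4) by (destruct Hs as [_ Hs]; unfold Rmax in Hs; destruct (Rle_dec 0 x); lra).
    rewrite Z0 in Es; change (P0 1%nat s) with (extend0 g 0 s) in Es; rewrite (extend0_out g (1/4) (3/4) 0 s E0) in Es by (intros ?; lra); lra. }
  apply (jet_vanish P0 0 (1/4) JP); intros e He.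
  assert (Pe : 0 < e / 2) by lra.
  exists (1/4 - e/2); split; [rewrite Rabs_left; lra|].
  exists (mkposreal _ Pe); intros y Hy; apply Zt.
  apply Rabs_def2 in Hy; simpl in Hy; unfold minus, plus, opp in Hy; simpl in Hy; lra. }
assert (Pr : 0 < P0 O (5/8)).
{ destruct (derive_mvt (P0 O) (P0 1%nat) (3/8) (5/8) (JP O)) as [t [Ht E]].
  rewrite Rmin_left, Rmax_right in Ht by lra.
  change (P0 1%nat t) with (extend0 g 0 t) in E; rewrite extend0_in in E by (unfold I01; lra).
  change (Derive01_n g 0 t) with (g t) in E; rewrite E1 in E by auto.
  assert (L := Mono (1/4) (3/8) ltac:(lra)); lra. }
(* [a] is the last zero of the primitive: the zeros are bounded by 5/8, where the primitive is
   positive thanks to the plateau of the bump. *)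
destruct (completeness (fun x => P0 O x = 0)) as [a [Ua La]].
- exists (5/8); intros x Hx; destruct (Rle_lt_dec x (5/8)); auto.
  assert (L := Mono (5/8) x ltac:(lra)); lra.
- now exists (1/4).
- assert (Ha1 : 1/4 <= a) by (now apply Ua).
  assert (Ha2 : a <= 5/8).
  { apply La; intros x Hx; destruct (Rle_lt_dec x (5/8)); auto.
    assert (L := Mono (5/8) x ltac:(lra)); lra. }
  assert (Neg : forall x, 1/4 <= x -> 0 <= P0 O x).
  { intros x Hx; rewrite <- Zl; now apply Mono. }
  assert (Za : forall x, x < a -> P0 O x = 0).
  { intros x Hx; destruct (Rle_lt_dec x (1/4)) as [L|L].
    - destruct (derive_mvt (P0 O) (P0 1%nat) 0 x (JP O)) as [s [Hs Es]].
      assert (s <= 1/4) by (destruct Hs as [_ Hs]; unfold Rmax in Hs; destruct (Rle_dec 0 x); lra).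
      destruct (Rlt_dec s (1/4)).
      + rewrite Z0 in Es; change (P0 1%nat s) with (extend0 g 0 s) in Es; rewrite (extend0_out g (1/4) (3/4) 0 s E0) in Es by (intros ?; lra); lra.
      + destruct Hs as [_ Hs]; unfold Rmax in Hs; destruct (Rle_dec 0 x); [|lra].
        now replace x with (1/4) by lra.
    - apply Rle_antisym; [|apply Neg; lra].
      destruct (Rle_lt_dec (P0 O x) 0) as [|L']; auto; exfalso.
      assert (a <= x); [|lra].
      apply La; intros y Hy; destruct (Rle_lt_dec y x) as [|L2]; auto.
      assert (L3 := Mono x y ltac:(lra)); lra. }
  assert (J' := jet_affine P0 1 a JP).
  (* The summand [2 / M 1] pays for orders 0 and 1, where the bounds are numerical; the summand 1
     pays for the orders inherited from the bump. *)
  exists (fun n x => 1 ^ n * P0 n (1 * x + a)), (2 / M 1%nat + 1), C.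
  assert (PM := P 1%nat (le_n _)).
  assert (P2 : 0 < 2 / M 1%nat) by (apply Rdiv_lt_0_compat; lra).
  split; [exact J'|]; split; [lra|]; split; [exact HC|]; split; [|split; [|split]].
  + intros n x Hx; rewrite pow1, !Rmult_1_l.
    destruct n as [|[|n]].
    * destruct (derive_mvt (P0 O) (P0 1%nat) 0 (x + a) (JP O)) as [s [_ Es]].
      rewrite Z0, !Rminus_0_r in Es; rewrite Es, Rabs_mult.
      replace (_ * C ^ 0 * _) with (1 * (2 + M 1%nat))
        by (unfold weight; simpl; field; lra).
      specialize (Rg' s); change (P0 1%nat s) with (extend0 g 0 s).
      apply Rmult_le_compat; try apply Rabs_pos; apply Rabs_le; split; lra.
    * specialize (Rg' (x + a)); change (P0 1%nat (x + a)) with (extend0 g 0 (x + a)); simpl pow.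
      replace (_ * (C * 1) * _) with (C * (2 + M 1%nat))
        by (unfold weight; simpl; field; lra).
      rewrite Rabs_right by lra; nra.
    (* Order [n + 2] of the primitive is order [n + 1] of the bump; both the weight and the power of
       [C] only grow with the index. *)
    * assert (PW := P (S n) ltac:(lia)).
      assert (PC : 1 <= C ^ S n) by now apply pow_R1_Rle.
      assert (L : Rabs (P0 (S (S n)) (x + a)) <= C ^ S n * M (S n)).
      { simpl P0; destruct (classic (I01 (x + a))) as [Ix|N].
        - rewrite extend0_in by auto; apply Bg; auto; lia.
        - rewrite (extend0_out g (1/4) (3/4)), Rabs_R0; auto; [nra|]; unfold I01 in N; lra. }
      apply Rle_trans with (1 := L).
      assert (LW := weight_le M (S n) P Hi).
      change (weight M (S n)) with (M (S n)) in LW.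
      apply Rmult_le_compat; try lra.
      change (C ^ S (S n)) with (C * C ^ S n).
      set (t := C ^ S n) in *; assert (t <= C * t) by nra; nra.
  + intros x Hx; simpl; rewrite !Rmult_1_l.
    destruct Hx as [Hx| ->]; [apply Za; lra|rewrite Rplus_0_l].
    (* The supremum [a] is itself a zero, because the primitive vanishes at all points to its
       left. *)
    apply (jet_vanish P0 0 a JP); intros e He.
    assert (Pe : 0 < e / 2) by lra.
    exists (a - e/2); split; [rewrite Rabs_left; lra|].
    exists (mkposreal _ Pe); intros y Hy; apply Za.
    apply Rabs_def2 in Hy; simpl in Hy; unfold minus, plus, opp in Hy; simpl in Hy; lra.
  + intros x Hx; simpl; rewrite !Rmult_1_l.
    destruct (Neg (x + a) ltac:(lra)) as [|E]; auto; exfalso.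
    assert (L := Ua (x + a) (eq_sym E)); lra.
  + intros x y L; simpl; rewrite !Rmult_1_l; apply Mono; lra.
Qed.

(** * The factors of the wells *)

Definition jsq (m : R) (n : nat) (x : R) : R :=
  match n with O => (x - m) ^ 2 | 1%nat => 2 * (x - m) | 2%nat => 2 | _ => 0 end.

Lemma jsq_jet (m : R) : jet (jsq m).
Proof.
intros [|[|[|n]]] x; cbv [jsq]; auto_derive; trivial; change R in x; ring.
Qed.

Lemma jsq_bound (M : nat -> R) (m : R) :
  (forall n, (1 <= n)%nat -> 0 < M n) -> log_increasing M -> I01 m ->
  carleman_bound M I01 (2 / M 1%nat) 1 (jsq m).
Proof.
unfold I01; intros P Hi Hm n x Hx.
assert (P1 := P 1%nat (le_n _)).
assert (W : M 1%nat <= weight M n) by (apply (weight_mono M 0 n P Hi); lia).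
rewrite pow1, Rmult_1_r.
apply Rle_trans with 2.
- destruct n as [|[|[|n]]]; simpl; apply Rabs_le; split; nra.
- apply Rle_trans with (2 / M 1%nat * M 1%nat); [right; field; lra|].
  apply Rmult_le_compat_l; auto; apply Rlt_le, Rdiv_lt_0_compat; lra.
Qed.

Definition jtrans (F : nat -> R -> R) (s b : R) (n : nat) (x : R) : R := s ^ n * F n (s * x + b).

Lemma jtrans_bound (M : nat -> R) (F : nat -> R -> R) (A c s b : R) :
  s = 1 \/ s = -1 -> (forall x, I01 x -> -1 <= s * x + b <= 1) ->
  carleman_bound M (fun x => -1 <= x <= 1) A c F ->
  carleman_bound M I01 A c (jtrans F s b).
Proof.
intros Hs Hb H n x Hx; unfold jtrans.
rewrite Rabs_mult, <- RPow_abs.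
replace (Rabs s) with 1 by (destruct Hs as [-> | ->]; [rewrite Rabs_right|rewrite Rabs_left]; lra).
rewrite pow1, Rmult_1_l; apply H; auto.
Qed.

Lemma carleman_bound_weaken (M : nat -> R) (D : R -> Prop) (A c A' c' : R) (F : nat -> R -> R) :
  (forall n, (1 <= n)%nat -> 0 < M n) -> 0 <= A <= A' -> 0 <= c <= c' ->
  carleman_bound M D A c F -> carleman_bound M D A' c' F.
Proof.
intros P HA Hc H n x Hx; apply Rle_trans with (1 := H n x Hx).
apply Rmult_le_compat_r; [apply Rlt_le, weight_pos; auto|].
apply Rmult_le_compat; try lra; [apply pow_le; lra|apply pow_incr; lra].
Qed.

(* The [k]-th well lives on [(rad (S k), rad k)], where [rad (S k) = rad k / 2]. *)
Definition rad (k : nat) : R := (/ 2) ^ k.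
(** The bottom of the well and the end of the stretch along which orbits are followed; both lie
    strictly inside the well, so the bump factor is bounded below between them. *)
Definition wmid (k : nat) : R := rad k * (5/8).
Definition wend (k : nat) : R := rad k * (3/4).

Lemma rad_pos (k : nat) : 0 < rad k.
Proof. apply pow_lt; lra. Qed.

Lemma rad_S (k : nat) : rad (S k) = rad k / 2.
Proof. unfold rad; simpl; lra. Qed.

Lemma rad_le (j k : nat) : (j <= k)%nat -> rad k <= rad j.
Proof.
intros L; induction L; [lra|].
rewrite rad_S; assert (P := rad_pos m); lra.
Qed.

Lemma rad_le1 (k : nat) : rad k <= 1.
Proof. exact (rad_le 0 k (Nat.le_0_l _)). Qed.

Definition wellf (G : R -> R) (k : nat) (x : R) : R :=
  (x - wmid k) ^ 2 * (G (x - rad (S k)) * G (rad k - x)).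

(** When [G] vanishes exactly on the nonpositive reals, this is positive on [(rad k, 1)] and fills
    in the zeros at the bottoms of earlier wells. *)
Definition basef (G : R -> R) (k : nat) (x : R) : R :=
  G (x - rad k) * G (1 - x).

(* [D k] controls the depth at [wmid j] for [j < k] only, since [basef G k]
   vanishes left of [rad k]. *)
Definition vterm (G : R -> R) (D : nat -> R) (k : nat) (x : R) : R :=
  wellf G k x + D k * basef G k x.

(** The constants come before [D] and [k]: the series over [k] then keeps the geometric constant,
    and the depths can be chosen after all derivative bounds. *)
Lemma vterm_jet (M : nat -> R) (G : nat -> R -> R) (A c : R) :
  (forall n, (1 <= n)%nat -> 0 < M n) -> log_increasing M -> log_convex M ->
  jet G -> 0 <= A -> 1 <= c ->
  carleman_bound M (fun x => -1 <= x <= 1) A c G ->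
  exists B c', 0 <= B /\ 1 <= c' /\ forall D k, (forall k, 0 <= D k <= 1) ->
  exists U, jet U /\ (forall x, U O x = vterm (G O) D k x) /\ carleman_bound M I01 B c' U.
Proof.
intros P Hi Hc J HA Hcc HG.
assert (P1 := P 1%nat (le_n _)).
assert (P2 : 0 < 2 / M 1%nat) by (apply Rdiv_lt_0_compat; lra).
set (B1 := M 1%nat * A * A).
assert (HB1 : 0 <= B1) by (unfold B1; repeat apply Rmult_le_pos; lra).
set (B2 := M 1%nat * (2 / M 1%nat) * B1).
assert (HB2 : 0 <= B2) by (unfold B2; repeat apply Rmult_le_pos; lra).
(* Geometric constants add under products: 1 for the square and [c] for each of the two translates
   of [G]. *)
exists (B2 + B1), (1 + (c + c)); split; [lra|split; [lra|]]; intros D k HD.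
assert (Q := rad_pos k); assert (Q1 := rad_le1 k); assert (QS := rad_S k).
set (W := jmul (jsq (wmid k)) (jmul (jtrans G 1 (- rad (S k))) (jtrans G (-1) (rad k)))).
set (E := jmul (jtrans G 1 (- rad k)) (jtrans G (-1) 1)).
assert (JW : jet W) by (apply jet_mul; [apply jsq_jet|apply jet_mul; now apply jet_affine]).
assert (JE : jet E) by (apply jet_mul; now apply jet_affine).
assert (BW : carleman_bound M I01 B2 (1 + (c + c)) W).
{ apply carleman_bound_mul; auto; try lra.
  - apply jsq_bound; auto; unfold I01, wmid; lra.
  - apply carleman_bound_mul; auto; try lra; apply jtrans_bound; auto; unfold I01; intros; lra. }
assert (BE : carleman_bound M I01 B1 (1 + (c + c)) E).
{ apply carleman_bound_weaken with B1 (c + c); auto; try lra.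
  apply carleman_bound_mul; auto; try lra; apply jtrans_bound; auto; unfold I01; intros; lra. }
exists (fun n x => W n x + D k * E n x); split; [|split].
- intros n x; apply (is_derive_plus (W n) (fun t => D k * E n t)); [apply JW|].
  apply is_derive_scal, JE.
- intros x; unfold W, E, vterm, wellf, basef, jmul, jtrans, jsq, pow; rewrite !Rmult_1_l.
  replace (-1 * x + rad k) with (rad k - x) by ring.
  replace (-1 * x + 1) with (1 - x) by ring.
  reflexivity.
- intros n x Hx; specialize (BW n x Hx); specialize (BE n x Hx).
  apply Rle_trans with (1 := Rabs_triang _ _).
  rewrite Rabs_mult, (Rabs_right (D k)) by (apply Rle_ge, HD).
  assert (Rabs (E n x) * D k <= Rabs (E n x) * 1) by (apply Rmult_le_compat_l; [apply Rabs_pos|apply HD]).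
  lra.
Qed.

(** * The profile: positivity and bounds on the wells *)

Definition flat_at0 (G : R -> R) (A : R) : Prop :=
  (forall x, x <= 0 -> G x = 0) /\ (forall x, 0 < x -> 0 < G x) /\
  (forall x y, x <= y -> G x <= G y) /\ (forall x, x <= 1 -> G x <= A).

Lemma flat_at0_bounds (G : R -> R) (A x : R) : flat_at0 G A -> x <= 1 -> 0 <= G x <= A.
Proof.
intros (Z & P & Mo & B) Hx; split; auto.
destruct (Rle_lt_dec x 0); [rewrite Z; auto; lra|apply Rlt_le; auto].
Qed.

Definition prof (G : R -> R) (D : nat -> R) (x : R) : R :=
  Series (fun k => (/ 2) ^ k * vterm G D k x).

Lemma prod_bounds (a b A : R) : 0 <= a <= A -> 0 <= b <= A -> 0 <= a * b <= A * A.
Proof. intros; split; nra. Qed.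

Lemma basef_bounds (G : R -> R) (A x : R) (k : nat) :
  flat_at0 G A -> I01 x -> 0 <= basef G k x <= A * A.
Proof.
intros F Hx; unfold basef, I01 in *; assert (P := rad_pos k).
apply prod_bounds; apply flat_at0_bounds; auto; lra.
Qed.

Lemma wellf_bounds (G : R -> R) (A x : R) (k : nat) :
  flat_at0 G A -> I01 x -> 0 <= wellf G k x <= A * A * (x - wmid k) ^ 2.
Proof.
intros F Hx; unfold wellf, I01 in *.
assert (P := rad_pos (S k)); assert (Q := rad_le1 k).
assert (H : 0 <= G (x - rad (S k)) * G (rad k - x) <= A * A).
{ apply prod_bounds; apply flat_at0_bounds; auto; lra. }
assert (S2 := pow2_ge_0 (x - wmid k)); split; nra.
Qed.

Lemma vterm_bounds (G : R -> R) (A x : R) (D : nat -> R) (k : nat) :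
  flat_at0 G A -> I01 x -> 0 <= D k <= 1 ->
  wellf G k x <= vterm G D k x /\ D k * basef G k x <= vterm G D k x /\
  0 <= vterm G D k x <= A * A * 2.
Proof.
intros F Hx HD; unfold vterm.
assert (B1 := basef_bounds G A x k F Hx); assert (B2 := wellf_bounds G A x k F Hx).
assert (W : 0 <= (x - wmid k) ^ 2 <= 1).
{ assert (P := rad_pos k); assert (Q := rad_le1 k); unfold wmid, I01 in *.
  set (t := x - rad k * (5 / 8)); assert (-1 <= t <= 1) by (unfold t; lra); split; nra. }
repeat split; nra.
Qed.

Lemma Series_nonneg (u : nat -> R) : (forall k, 0 <= u k) -> ex_series u -> 0 <= Series u.
Proof.
intros H X; replace 0 with (Series (fun n => 0 * u n)) by (rewrite Series_scal_l; ring).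
apply Series_le; auto; intros n; specialize (H n); lra.
Qed.

Lemma Series_ge_term (u : nat -> R) (k : nat) :
  (forall k, 0 <= u k) -> ex_series u -> u k <= Series u.
Proof.
revert u; induction k as [|k IH]; intros u H X; rewrite Series_incr_1 by auto.
- assert (0 <= Series (fun k => u (S k))); [|lra].
  apply Series_nonneg; auto; now apply -> (ex_series_incr_1 (K := R_AbsRing) (V := R_NormedModule) u).
- apply Rle_trans with (Series (fun k => u (S k))).
  + apply (IH (fun k => u (S k))); auto; now apply -> (ex_series_incr_1 (K := R_AbsRing) (V := R_NormedModule) u).
  + specialize (H O); lra.
Qed.

Lemma prof_ge_term (G : R -> R) (A x : R) (D : nat -> R) (k : nat) :
  flat_at0 G A -> (forall k, 0 <= D k <= 1) -> I01 x ->
  (/ 2) ^ k * vterm G D k x <= prof G D x.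
Proof.
intros F HD Hx.
apply (Series_ge_term (fun k => (/ 2) ^ k * vterm G D k x)).
- intros j; apply Rmult_le_pos; [apply pow_le; lra|]; now apply (vterm_bounds G A).
- apply ex_series_half with (A * A * 2); intros j.
  destruct (vterm_bounds G A x D j F Hx (HD j)) as [_ [_ [L U]]].
  now rewrite Rabs_right by lra.
Qed.

(** Some [k] has [rad k < x], and its base term is already positive at [x]. *)
Lemma prof_pos (G : R -> R) (A x : R) (D : nat -> R) :
  flat_at0 G A -> (forall k, 0 < D k <= 1) -> 0 < x < 1 -> 0 < prof G D x.
Proof.
intros F HD Hx.
destruct (pow_lt_1_zero (/ 2) ltac:(rewrite Rabs_right; lra) x ltac:(lra)) as [k Hk].
specialize (Hk k (le_n _)).
assert (P := rad_pos k); unfold rad in P; rewrite Rabs_right in Hk by lra.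
assert (HD' : forall k, 0 <= D k <= 1) by (intros j; specialize (HD j); lra).
assert (Ix : I01 x) by (unfold I01; lra).
apply Rlt_le_trans with (2 := prof_ge_term G A x D k F HD' Ix).
apply Rmult_lt_0_compat; auto.
apply Rlt_le_trans with (D k * basef G k x).
- apply Rmult_lt_0_compat; [apply HD|]; destruct F as (_ & FP & _).
  apply Rmult_lt_0_compat; apply FP; unfold rad; lra.
- now apply (vterm_bounds G A).
Qed.

(** For nondecreasing nonnegative [G], a lower bound on [[wmid k, wend k]] for the weighted bump
    factor: each of the two translates is taken at the endpoint where it is smallest. *)
Definition wconst (G : R -> R) (k : nat) : R :=
  (/ 2) ^ k * (G (wmid k - rad (S k)) * G (rad k - wend k)).

Lemma wconst_pos (G : R -> R) (A : R) (k : nat) : flat_at0 G A -> 0 < wconst G k.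
Proof.
intros (_ & FP & _); assert (P := rad_pos k).
apply Rmult_lt_0_compat; [exact P|apply Rmult_lt_0_compat; apply FP];
  rewrite ?rad_S; unfold wmid, wend; lra.
Qed.

Lemma prof_lower (G : R -> R) (A x : R) (D : nat -> R) (k : nat) :
  flat_at0 G A -> (forall k, 0 <= D k <= 1) -> wmid k <= x <= wend k ->
  wconst G k * (x - wmid k) ^ 2 <= prof G D x.
Proof.
intros F HD Hx; assert (P := rad_pos k); assert (Q := rad_le1 k).
assert (Ix : I01 x) by (unfold I01, wmid, wend in *; lra).
apply Rle_trans with (2 := prof_ge_term G A x D k F HD Ix).
unfold wconst; rewrite Rmult_assoc; apply Rmult_le_compat_l; [apply Rlt_le, P|].
apply Rle_trans with (wellf G k x); [|now apply (vterm_bounds G A)].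
unfold wellf; rewrite Rmult_comm; apply Rmult_le_compat_l; [apply pow2_ge_0|].
assert (B1 := flat_at0_bounds G A (wmid k - rad (S k)) F).
assert (B2 := flat_at0_bounds G A (rad k - wend k) F).
rewrite rad_S in *; unfold wmid, wend in *.
destruct F as (_ & _ & Mo & _).
apply Rmult_le_compat; try (apply B1; lra); try (apply B2; lra); apply Mo; lra.
Qed.

(** On this interval every well except the [k]-th vanishes, and so does every base term of index at
    most [k]; only depths of later index remain, all at most [d]. *)
Lemma prof_upper (G : R -> R) (A x d : R) (D : nat -> R) (k : nat) :
  flat_at0 G A -> (forall k, 0 <= D k <= 1) -> 0 <= d ->
  (forall j, (k < j)%nat -> D j <= d) -> wmid k <= x <= wend k ->
  prof G D x <= 2 * (A * A * ((x - wmid k) ^ 2 + d)).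
Proof.
intros F HD Hd Hj Hx; assert (P := rad_pos k); assert (Q := rad_le1 k).
assert (Ix : I01 x) by (unfold I01, wmid, wend in *; lra).
apply Rle_trans with (1 := Rle_abs _).
apply (Series_half_bound (fun k => vterm G D k x)); intros j.
destruct (vterm_bounds G A x D j F Ix (HD j)) as [_ [_ [L _]]].
rewrite Rabs_right by lra; clear L; unfold vterm.
assert (B1 := basef_bounds G A x j F Ix); assert (B2 := wellf_bounds G A x j F Ix).
assert (SQ := pow2_ge_0 (x - wmid k)).
destruct F as (Z & _).
assert (X1 : wellf G j x <= A * A * (x - wmid k) ^ 2).
{ destruct (Nat.lt_trichotomy j k) as [L|[->|L]]; [|lra|].
  - unfold wellf; rewrite (Z (x - rad (S j))).
    + rewrite Rmult_0_l, Rmult_0_r; nra.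
    + assert (R := rad_le (S j) k L); unfold wend in Hx; lra.
  - unfold wellf; rewrite (Z (rad j - x)).
    + rewrite !Rmult_0_r; nra.
    + assert (R := rad_le (S k) j L); rewrite rad_S in R; unfold wmid in Hx; lra. }
assert (X2 : D j * basef G j x <= A * A * d).
{ destruct (Nat.le_gt_cases j k) as [L|L].
  - unfold basef; rewrite (Z (x - rad j)).
    + rewrite Rmult_0_l, Rmult_0_r; nra.
    + assert (R := rad_le j k L); unfold wend in Hx; lra.
  - specialize (Hj j L); specialize (HD j).
    rewrite (Rmult_comm (A * A)); apply Rmult_le_compat; lra. }
lra.
Qed.

Lemma vterm_out (G : R -> R) (A x : R) (D : nat -> R) (k : nat) :
  flat_at0 G A -> x <= 0 \/ 1 <= x -> vterm G D k x = 0.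
Proof.
intros (Z & _) Hx; assert (P := rad_pos k); assert (P' := rad_pos (S k)); assert (Q := rad_le1 k).
unfold vterm, wellf, basef; destruct Hx as [Hx|Hx].
- rewrite (Z (x - rad k)), (Z (x - rad (S k))) by lra; ring.
- rewrite (Z (rad k - x)), (Z (1 - x)) by lra; ring.
Qed.

Lemma jet_vanish_outside (F : nat -> R -> R) (n : nat) (x : R) :
  jet F -> (forall x, x <= 0 \/ 1 <= x -> F O x = 0) -> x <= 0 \/ 1 <= x -> F n x = 0.
Proof.
intros J Z Hx; apply jet_vanish; auto; intros e He.
assert (Pe : 0 < e / 2) by lra.
destruct Hx as [Hx|Hx]; [exists (x - e / 2)|exists (x + e / 2)];
  (split; [unfold Rabs; destruct (Rcase_abs _); lra|]);
  exists (mkposreal _ Pe); intros y Hy; apply Z;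
  apply Rabs_def2 in Hy; simpl in Hy; unfold minus, plus, opp in Hy; simpl in Hy; lra.
Qed.

Lemma prof_jet (M : nat -> R) (G : nat -> R -> R) (A c A' : R) :
  (forall n, (1 <= n)%nat -> 0 < M n) -> log_increasing M -> log_convex M ->
  jet G -> 0 <= A -> 1 <= c ->
  carleman_bound M (fun x => -1 <= x <= 1) A c G -> flat_at0 (G O) A' ->
  exists B c', 0 <= B /\ 1 <= c' /\ forall D, (forall k, 0 <= D k <= 1) ->
  exists V, jet V /\ (forall x, V O x = prof (G O) D x) /\
    (forall n x, x <= 0 \/ 1 <= x -> V n x = 0) /\
    carleman_bound M (fun _ => True) B c' V.
Proof.
intros P Hi Hc J HA Hcc HG F.
destruct (vterm_jet M G A c P Hi Hc J HA Hcc HG) as [B [c' [HB [Hc' H]]]].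
exists (2 * B), c'; split; [lra|split; auto]; intros D HD.
destruct (functional_choice _ (fun k => H D k HD)) as [U HU].
assert (JU : forall k, jet (U k)) by (intros; apply HU).
assert (ZU : forall k n x, x <= 0 \/ 1 <= x -> U k n x = 0).
{ intros k n x Hx; apply jet_vanish_outside; auto; intros y Hy.
  destruct (HU k) as [_ [E _]]; rewrite E; now apply vterm_out with A'. }
(* Each term is flat at 0 and 1 and zero beyond, so its bound on [0,1] holds on the whole line. *)
assert (BU : forall k n x, Rabs (U k n x) <= B * c' ^ n * weight M n).
{ intros k n x; destruct (classic (I01 x)) as [Hx|Hx].
  - now apply HU.
  - rewrite ZU, Rabs_R0 by (unfold I01 in Hx; lra).
    repeat apply Rmult_le_pos; auto; [apply pow_le; lra|apply Rlt_le, weight_pos, P]. }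
exists (jseries U); split; [|split; [|split]].
- now apply jet_series with (fun n => B * c' ^ n * weight M n).
- intros x; apply Series_ext; intros k; destruct (HU k) as [_ [E _]]; now rewrite E.
- intros n x Hx; unfold jseries.
  replace 0 with (0 * Series (fun k : nat => (/ 2) ^ k)) by ring.
  rewrite <- Series_scal_l; apply Series_ext; intros k; rewrite ZU by auto; ring.
- intros n x _; rewrite !Rmult_assoc; apply Series_half_bound; intros k.
  rewrite <- Rmult_assoc; apply BU.
Qed.

(** * Diffeomorphisms and growth *)

(* The algebra generated by the [F n o g] and [1 / (F 1 o g)] is closed under
   differentiation because [g' = 1 / (F 1 o g)]; hence [g] is smooth. *)
Inductive inverse_algebra (F : nat -> R -> R) (g : R -> R) : (R -> R) -> Prop :=
| ia_jet n : inverse_algebra F g (fun y => F n (g y))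
| ia_inv : inverse_algebra F g (fun y => / F 1%nat (g y))
| ia_opp h : inverse_algebra F g h -> inverse_algebra F g (fun y => - h y)
| ia_add h k : inverse_algebra F g h -> inverse_algebra F g k ->
    inverse_algebra F g (fun y => h y + k y)
| ia_mul h k : inverse_algebra F g h -> inverse_algebra F g k ->
    inverse_algebra F g (fun y => h y * k y).

Lemma inverse_algebra_derive (F : nat -> R -> R) (g h : R -> R) :
  jet F -> (forall x, F 1%nat x <> 0) ->
  (forall y, is_derive g y (/ F 1%nat (g y))) ->
  inverse_algebra F g h ->
  exists h', (forall y, is_derive h y (h' y)) /\ inverse_algebra F g h'.
Proof.
intros J N Dg; assert (DF : forall n y, is_derive (fun y => F n (g y)) y (/ F 1%nat (g y) * F (S n) (g y))).
{ intros n y; apply (is_derive_comp (F n) g); [apply J|apply Dg]. }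
induction 1 as [n| |h Hh [h' [D' A']]|h k Hh [h' [Dh Ah]] Hk [k' [Dk Ak]]|h k Hh [h' [Dh Ah]] Hk [k' [Dk Ak]]].
- exists (fun y => / F 1%nat (g y) * F (S n) (g y)); split; auto.
  apply ia_mul; constructor.
- exists (fun y => - (/ F 1%nat (g y) * F 2%nat (g y) * (/ F 1%nat (g y) * / F 1%nat (g y)))); split.
  + intros y; replace (- _) with (- (/ F 1%nat (g y) * F 2%nat (g y)) / (F 1%nat (g y)) ^ 2) by (field; auto).
    apply (is_derive_inv (fun y => F 1%nat (g y))); auto.
  + apply ia_opp; repeat apply ia_mul; constructor.
- exists (fun y => - h' y); split; [|now constructor].
  intros y; apply (is_derive_opp (K := R_AbsRing) (V := R_NormedModule) h); auto.
- exists (fun y => h' y + k' y); split; [|now constructor].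
  intros y; apply (is_derive_plus (K := R_AbsRing) (V := R_NormedModule) h k); auto.
- exists (fun y => h' y * k y + h y * k' y); split; [|now repeat constructor].
  intros y; apply (is_derive_mult h k); auto; apply Rmult_comm.
Qed.

Lemma inverse_algebra_smooth01 (F : nat -> R -> R) (g : R -> R) :
  jet F -> (forall x, F 1%nat x <> 0) ->
  (forall y, is_derive g y (/ F 1%nat (g y))) -> smooth01 g.
Proof.
intros J N Dg.
assert (H : forall n, exists h, inverse_algebra F g h /\ forall y, I01 y -> Derive01_n g (S n) y = h y).
{ induction n as [|n [h [Ah Eh]]].
  - exists (fun y => / F 1%nat (g y)); split; [constructor|].
    intros y Hy; apply is_derive01_unique, is_derive_is_derive01; auto.
  - destruct (inverse_algebra_derive F g h J N Dg Ah) as [h' [Dh Ah']].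
    exists h'; split; auto; intros y Hy; apply is_derive01_unique; auto.
    apply is_derive01_ext_loc with (f := h) (d := 1); auto; [lra| |].
    + intros; symmetry; now apply Eh.
    + apply is_derive_is_derive01, Dh. }
intros [|n] y Hy.
- eexists; apply is_derive_is_derive01, Dg.
- destruct (H n) as [h [Ah Eh]].
  destruct (inverse_algebra_derive F g h J N Dg Ah) as [h' [Dh _]].
  exists (h' y); apply is_derive01_ext_loc with (f := h) (d := 1); auto; [lra| |].
  + intros; symmetry; now apply Eh.
  + apply is_derive_is_derive01, Dh.
Qed.

Lemma jet_continuity (F : nat -> R -> R) (n : nat) : jet F -> continuity (F n).
Proof.
intros J x; apply continuity_pt_filterlim, (ex_derive_continuous (K := R_AbsRing) (V := R_NormedModule)).
eexists; apply J.
Qed.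

(** The lower bound on the derivative makes [F O] expand distances by at least [t], which gives
    injectivity and a Lipschitz inverse; being the identity off [0,1] gives surjectivity by
    intermediate values. *)
Lemma diffeo_of_jet (F : nat -> R -> R) (t B : R) :
  jet F -> (forall x, x <= 0 \/ 1 <= x -> F O x = x) ->
  0 < t -> (forall x, t <= F 1%nat x) -> (forall x, Rabs (F 2%nat x) <= B) ->
  exists f : Diff01, dfun f = F O.
Proof.
intros J Out Pt H1 H2.
assert (Exp : forall x y, t * Rabs (y - x) <= Rabs (F O y - F O x)).
{ intros x y; destruct (derive_mvt _ _ x y (J O)) as [s [_ ->]].
  rewrite Rabs_mult; apply Rmult_le_compat_r; [apply Rabs_pos|].
  apply Rle_trans with (1 := H1 s), Rle_abs. }
assert (Inj : forall x y, F O x = F O y -> x = y).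
{ intros x y E; specialize (Exp y x); rewrite E, Rminus_diag, Rabs_R0 in Exp.
  destruct (Req_dec x y); auto.
  assert (0 < Rabs (x - y)) by (apply Rabs_pos_lt; lra); nra. }
assert (Mo : forall x y, x <= y -> F O x <= F O y).
{ intros x y; apply is_derive_nondecreasing with (F 1%nat); [apply J|].
  intros s; specialize (H1 s); lra. }
assert (Sur : forall y, exists x, F O x = y).
{ intros y; destruct (IVT_gen (F O) (Rmin y 0) (Rmax y 1) y (jet_continuity F O J)) as [x [_ E]]; eauto.
  assert (L := Rmin_r y 0); assert (L' := Rmax_r y 1).
  rewrite (Out (Rmin y 0)), (Out (Rmax y 1)) by lra.
  assert (L1 := Rmin_l y 0); assert (L2 := Rmax_l y 1).
  rewrite Rmin_left, Rmax_right; lra. }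
destruct (functional_choice _ Sur) as [g Hg].
assert (N : forall x, F 1%nat x <> 0) by (intros x; specialize (H1 x); lra).
assert (Dg : forall y, is_derive g y (/ F 1%nat (g y))).
(* Taylor's estimate for [F O] at [g y] is divided by the slope [a >= t], and [|g w - g y|] is at
   most [|w - y| / t]. *)
{ intros y; apply quadratic_error_is_derive with (/ t * B * (/ t) ^ 2); intros w.
  assert (T := jet_taylor F 0 B (g y) (g w) J H2); rewrite !Hg in T.
  specialize (Exp (g y) (g w)); rewrite !Hg in Exp.
  set (a := F 1%nat (g y)) in *; assert (Ha := H1 (g y)); fold a in Ha.
  replace (g w - g y - / a * (w - y)) with (- (/ a * (w - y - a * (g w - g y)))) by (field; lra).
  rewrite Rabs_Ropp, Rabs_mult, (Rabs_right (/ a)), !Rmult_assoc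
    by (apply Rle_ge, Rlt_le, Rinv_0_lt_compat; lra).
  apply Rmult_le_compat; [apply Rlt_le, Rinv_0_lt_compat; lra|apply Rabs_pos| |].
  { apply Rinv_le_contravar; lra. }
  apply Rle_trans with (1 := T); apply Rmult_le_compat_l.
  { apply Rle_trans with (2 := H2 0), Rabs_pos. }
  rewrite <- Rpow_mult_distr, <- (pow2_abs (g w - g y)), <- (pow2_abs (/ t * _)).
  apply pow_incr; split; [apply Rabs_pos|].
  rewrite Rabs_mult, (Rabs_right (/ t)) by (apply Rle_ge, Rlt_le, Rinv_0_lt_compat; lra).
  apply Rmult_le_reg_l with t; auto; rewrite <- Rmult_assoc, Rinv_r, Rmult_1_l by lra; exact Exp. }
assert (E0 : F O 0 = 0) by (apply Out; lra).
assert (E1 : F O 1 = 1) by (apply Out; lra).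
unshelve eexists.
{ refine (Build_Diff01 (F O) g _ _ _ _ _ _ E0 E1).
  - intros x [Hx Hx']; split; [rewrite <- E0|rewrite <- E1]; auto.
  - intros y [Hy Hy']; split.
    + destruct (Rle_lt_dec 0 (g y)) as [|L]; auto.
      assert (E := Hg y); rewrite Out in E; lra.
    + destruct (Rle_lt_dec (g y) 1) as [|L]; auto.
      assert (E := Hg y); rewrite Out in E; lra.
  - intros x _; apply Inj, Hg.
  - intros x _; apply Hg.
  - now apply jet_smooth01 with F.
  - now apply inverse_algebra_smooth01 with F. }
reflexivity.
Qed.

(** * Lower bounds for the growth sequence *)

Lemma max01_mvt (h : R -> R) (m a b : R) :
  C1_self h -> is_max01 (fun x => Rabs (Derive01 h x)) m ->
  0 < a < b -> b < 1 -> h b - h a <= m * (b - a).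
Proof.
intros [_ H] [_ Hm] Hab Hb.
assert (D : forall x, a <= x <= b -> is_derive h x (Derive01 h x)).
{ intros x Hx; apply is_derive01_interior; [lra|].
  apply Derive01_correct; [|apply H]; unfold I01; lra. }
destruct (MVT_gen h a b (Derive01 h)) as [s [Hs E]].
- intros x Hx; apply D; rewrite Rmin_left, Rmax_right in Hx by lra; lra.
- intros x Hx; rewrite Rmin_left, Rmax_right in Hx by lra.
  apply continuity_pt_filterlim, (ex_derive_continuous (K := R_AbsRing) (V := R_NormedModule)).
  eexists; now apply D.
- rewrite E; apply Rmult_le_compat_r; [lra|].
  rewrite Rmin_left, Rmax_right in Hs by lra.
  apply Rle_trans with (1 := Rle_abs _), Hm; unfold I01; lra.
Qed.

Lemma Gamma_ge_iter (f : Diff01) (n : nat) (a b : R) :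
  0 < a < b -> b < 1 ->
  Nat.iter n (dfun f) b - Nat.iter n (dfun f) a <= Gamma f n * (b - a).
Proof.
intros Ha Hb; destruct (Gamma_spec f n) as [m [m' [Hm [_ ->]]]].
apply Rle_trans with (m * (b - a)).
- apply max01_mvt; auto.
  apply C1_self_iter, C1_self_smooth; [apply dfun_I01|apply dfun_smooth].
- apply Rmult_le_compat_r; [lra|apply Rmax_l].
Qed.

Lemma Gamma_ge_iter_inv (f : Diff01) (n : nat) (a b : R) :
  0 < a < b -> b < 1 ->
  Nat.iter n (dinv f) b - Nat.iter n (dinv f) a <= Gamma f n * (b - a).
Proof.
intros Ha Hb; destruct (Gamma_spec f n) as [m [m' [_ [Hm ->]]]].
apply Rle_trans with (m' * (b - a)).
- apply max01_mvt; auto.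
  apply C1_self_iter, C1_self_smooth; [apply dinv_I01|apply dinv_smooth].
- apply Rmult_le_compat_r; [lra|apply Rmax_r].
Qed.

Lemma iter_continuity (h : R -> R) (n : nat) : continuity h -> continuity (Nat.iter n h).
Proof.
intros H; induction n as [|n IH].
- intros x; exact (derivable_continuous_pt id x (derivable_pt_id x)).
- exact (continuity_comp (Nat.iter n h) h IH H).
Qed.

Lemma iter_comm (h : R -> R) (n : nat) (x : R) : Nat.iter n h (h x) = h (Nat.iter n h x).
Proof. induction n; simpl; congruence. Qed.

(* The lower bound [c (x - m)^2] pushes the orbit of [m + 2 / (c n)] beyond [z]
   within [n] steps, the smallness of [d] keeps the orbit of [m] below [z]; so
   some point in between reaches [z] in exactly [n] steps. *)
Lemma well_escape (h u : R -> R) (c K d m z : R) (n : nat) :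
  continuity h -> (forall x, h x = x + u x) -> (forall x, 0 <= u x) ->
  0 < c <= 1 -> 0 <= K -> 0 <= d -> m < z <= m + 1 ->
  (forall x, m <= x <= z -> c * (x - m) ^ 2 <= u x <= K * (x - m) ^ 2 + d) ->
  (1 <= n)%nat -> 2 / (c * INR n) <= z - m ->
  d * INR n ^ 2 <= 1 -> 4 * K * d * INR n ^ 2 <= 1 -> 2 * d * INR n <= z - m ->
  exists x, m <= x <= z /\ Nat.iter n h x = z /\ u x * INR n ^ 2 <= 4 * K / c ^ 2 + 1.
Proof.
intros Ch Eh Pu Hc HK Hd Hz Hu Hn Hs D1 D2 D3.
assert (Pn : 1 <= INR n) by (apply (le_INR 1); auto).
set (s := 2 / (c * INR n)) in *.
assert (Ps : 0 < s) by (apply Rdiv_lt_0_compat; nra).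
(* While the orbit of [m] stays within [2 d n] of [m], the hypothesis [D2] gives [K (x - m)^2 <= d],
   so one step moves it by at most [2 d]. *)
assert (Slow : forall i, (i <= n)%nat -> m <= Nat.iter i h m <= m + 2 * d * INR i).
{ induction i as [|i IH]; intros Hi; [simpl; lra|].
  specialize (IH ltac:(lia)); simpl Nat.iter; rewrite S_INR, Eh.
  assert (Li : INR i + 1 <= INR n) by (rewrite <- S_INR; apply le_INR; auto).
  assert (Pi := pos_INR i).
  set (x := Nat.iter i h m) in *; specialize (Pu x).
  assert (Q : 2 * d * INR i <= 2 * d * INR n) by (apply Rmult_le_compat_l; lra).
  specialize (Hu x ltac:(lra)).
  assert (Q1 : (x - m) ^ 2 <= (2 * d * INR n) ^ 2) by (apply pow_incr; lra).
  assert (Q2 : K * (x - m) ^ 2 <= d).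
  { apply Rle_trans with (K * (2 * d * INR n) ^ 2); [now apply Rmult_le_compat_l|].
    replace (K * (2 * d * INR n) ^ 2) with (d * (4 * K * d * INR n ^ 2)) by ring; nra. }
  lra. }
(* The invariant says [x - m >= 2 / (c (n - i))], the discrete form of blow-up for [y' = c y^2 / 2].
   It cannot hold at [i = n], so [z] has been passed by then. *)
assert (Fast : forall i, (i <= n)%nat -> let x := Nat.iter i h (m + s) in
  z <= x \/ m <= x /\ 1 <= (x - m) * (INR n - INR i) * c / 2).
{ induction i as [|i IH]; intros Hi.
  - right; simpl; split; [lra|]; right; unfold s; field; lra.
  - specialize (IH ltac:(lia)); simpl Nat.iter in *; cbv zeta in *; rewrite S_INR, Eh.
    set (x := Nat.iter i h (m + s)) in *; specialize (Pu x).
    destruct IH as [L|[Lm L]]; [left; lra|].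
    destruct (Rle_lt_dec z x) as [Lz|Lz]; [left; lra|].
    specialize (Hu x ltac:(lra)).
    assert (Li : INR i + 1 <= INR n) by (rewrite <- S_INR; apply le_INR; auto).
    right; split; [lra|].
    set (y := x - m) in *; set (k := INR n - INR i) in *.
    apply Rle_trans with ((y + c * y ^ 2) * (k - 1) * c / 2).
    + assert (Hy : 0 <= y <= 1) by (unfold y; lra).
      assert (Hcy : 0 <= c * y <= 1) by (split; nra).
      replace ((y + c * y ^ 2) * (k - 1) * c / 2) with
        ((1 + c * y) * (y * k * c / 2 - c * y / 2)) by field.
      (* The product is at least 1 because [0 <= c y <= 1]. *)
      apply Rle_trans with ((1 + c * y) * (1 - c * y / 2)); [nra|].
      apply Rmult_le_compat_l; lra.
    + replace (INR n - (INR i + 1)) with (k - 1) by (unfold k; ring).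
      replace (x + u x - m) with (y + u x) by (unfold y; ring).
      unfold Rdiv; apply Rmult_le_compat_r; [lra|].
      apply Rmult_le_compat_r; [lra|].
      apply Rmult_le_compat_r; [unfold k; lra|lra]. }
assert (L0 := Slow n (le_n _)).
assert (L1 : z <= Nat.iter n h (m + s)).
{ destruct (Fast n (le_n _)) as [L|[_ L]]; auto; cbv zeta in L.
  rewrite Rminus_diag in L; lra. }
destruct (IVT_gen (Nat.iter n h) m (m + s) z (iter_continuity h n Ch)) as [x [Hx Ex]].
{ rewrite Rmin_left, Rmax_right by lra; lra. }
rewrite Rmin_left, Rmax_right in Hx by lra.
exists x; split; [lra|split; auto].
specialize (Hu x ltac:(lra)).
assert (Q : (x - m) ^ 2 <= s ^ 2) by (apply pow_incr; lra).
apply Rle_trans with ((K * s ^ 2 + d) * INR n ^ 2).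
- apply Rmult_le_compat_r; [apply pow2_ge_0|]; nra.
- replace ((K * s ^ 2 + d) * INR n ^ 2) with (4 * K / c ^ 2 + d * INR n ^ 2)
    by (unfold s; field; lra).
  lra.
Qed.

Lemma iter_dinv_dfun (f : Diff01) (n : nat) (x : R) :
  I01 x -> Nat.iter n (dinv f) (Nat.iter n (dfun f) x) = x.
Proof.
intros Hx; induction n as [|n IH]; auto; simpl.
rewrite <- (iter_comm (dinv f) n), dfunK; auto.
clear IH; induction n; auto; simpl; now apply dfun_I01.
Qed.

Lemma iter_interior (h : R -> R) (n : nat) (x : R) :
  (forall x, 0 < x < 1 -> 0 < h x < 1) -> 0 < x < 1 -> 0 < Nat.iter n h x < 1.
Proof. intros H Hx; induction n; simpl; auto. Qed.

Lemma iter_expansion (h : R -> R) (L : R) (n : nat) (x y : R) :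
  0 <= L -> (forall x y, x < y -> 0 < h y - h x <= L * (y - x)) -> x < y ->
  0 < Nat.iter n h y - Nat.iter n h x <= L ^ n * (y - x).
Proof.
intros HL H Hxy; induction n as [|n IH]; simpl; [lra|].
specialize (H (Nat.iter n h x) (Nat.iter n h y) ltac:(lra)); split; [lra|].
apply Rle_trans with (1 := proj2 H); rewrite Rmult_assoc.
apply Rmult_le_compat_l; lra.
Qed.

Lemma jet_increment (F : nat -> R -> R) (L x y : R) :
  jet F -> (forall x, 0 < F 1%nat x <= L) -> x < y -> 0 < F O y - F O x <= L * (y - x).
Proof.
intros J H Hxy; destruct (derive_mvt _ _ x y (J O)) as [s [_ ->]].
specialize (H s); split; [apply Rmult_lt_0_compat; lra|apply Rmult_le_compat_r; lra].
Qed.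

Lemma diffeo_interior (f : Diff01) (x : R) :
  (forall x y, x < y -> dfun f x < dfun f y) -> 0 < x < 1 -> 0 < dfun f x < 1.
Proof.
intros H Hx; assert (H0 := H 0 x); assert (H1 := H x 1).
rewrite dfun_0 in H0; rewrite dfun_1 in H1; lra.
Qed.

(** The first step shrinks a short interval at [p] by a factor at most [2 F 1 p], and later steps
    stretch by at most [L] each. The inverse iterate must undo this, which bounds its derivative
    below. *)
Lemma Gamma_ge_contraction (f : Diff01) (F : nat -> R -> R) (B L p : R) (n : nat) :
  jet F -> dfun f = F O -> (forall x, 0 < F 1%nat x <= L) ->
  (forall x, Rabs (F 2%nat x) <= B) -> 1 <= L -> 0 < p < 1 -> (1 <= n)%nat ->
  1 <= Gamma f n * (2 * F 1%nat p * L ^ n).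
Proof.
intros J Ef H1 H2 HL Hp Hn.
set (t := F 1%nat p); assert (Ht : 0 < t) by apply H1.
assert (HB : 0 <= B) by (apply Rle_trans with (2 := H2 0), Rabs_pos).
(* The length [e] keeps [p + e] inside (0,1) and makes the quadratic error [B e^2] at most [t e]. *)
set (e := Rmin ((1 - p) / 2) (t / (B + 1))).
assert (He0 : 0 < t / (B + 1)) by (apply Rdiv_lt_0_compat; lra).
assert (He : 0 < e) by (apply Rmin_pos; lra).
assert (He1 : e <= (1 - p) / 2) by apply Rmin_l.
assert (He2 : B * e <= t).
{ apply Rle_trans with ((B + 1) * (t / (B + 1))); [|right; field; lra].
  apply Rmult_le_compat; try lra; apply Rmin_r. }
assert (T := jet_taylor F 0 B p (p + e) J H2); fold t in T.
replace (p + e - p) with e in T by ring.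
assert (Step : F O (p + e) - F O p <= 2 * t * e).
{ apply Rle_trans with (t * e + B * e ^ 2); [|simpl; nra].
  assert (X := Rle_abs (F O (p + e) - F O p - t * e)); lra. }
assert (Inc : forall x y, x < y -> 0 < dfun f y - dfun f x <= L * (y - x)).
{ intros x y; rewrite Ef; now apply jet_increment. }
assert (Int : forall x, 0 < x < 1 -> 0 < dfun f x < 1).
{ intros x; apply diffeo_interior; intros y z Hyz; specialize (Inc y z Hyz); lra. }
destruct n as [|n]; [lia|].
set (a := Nat.iter (S n) (dfun f) p); set (b := Nat.iter (S n) (dfun f) (p + e)).
assert (Ia : 0 < a < 1) by (apply iter_interior; auto).
assert (Ib : 0 < b < 1) by (apply iter_interior; auto; lra).
assert (Hab : 0 < b - a <= L ^ n * (2 * t * e)).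
{ unfold a, b; simpl; rewrite <- !iter_comm.
  assert (Q := Inc p (p + e) ltac:(lra)).
  destruct (iter_expansion (dfun f) L n (dfun f p) (dfun f (p + e))) as [Q1 Q2]; auto; try lra.
  split; auto; apply Rle_trans with (1 := Q2), Rmult_le_compat_l; [apply pow_le; lra|].
  now rewrite Ef. }
assert (G := Gamma_ge_iter_inv f (S n) a b ltac:(lra) ltac:(lra)).
unfold a, b in G; rewrite !iter_dinv_dfun in G by (unfold I01; lra); fold a b in G.
assert (Gp : 0 < Gamma f (S n)) by nra.
apply Rmult_le_reg_r with e; auto.
apply Rle_trans with (Gamma f (S n) * (b - a)); [lra|].
rewrite Rmult_assoc; apply Rmult_le_compat_l; [lra|].
apply Rle_trans with (1 := proj2 Hab).
assert (0 < L ^ n) by (apply pow_lt; lra).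
replace (2 * t * L ^ S n * e) with (L * (L ^ n * (2 * t * e))) by (simpl; ring).
assert (0 < t * e) by now apply Rmult_lt_0_compat.
nra.
Qed.

(** The [n]-th iterate carries [[x, f x]] onto [[z, f z]], with lengths [u x] and [u z]; the escape
    estimate makes the first of order [1 / n^2], while the second is at least [c (z - m)^2]. *)
Lemma Gamma_ge_well (f : Diff01) (u : R -> R) (c K d m z : R) (n : nat) :
  continuity (dfun f) -> (forall x y, x < y -> dfun f x < dfun f y) ->
  (forall x, dfun f x = x + u x) -> (forall x, 0 <= u x) ->
  (forall x, 0 < x < 1 -> 0 < u x) ->
  0 < c <= 1 -> 0 <= K -> 0 <= d -> 0 < m -> m < z < 1 ->
  (forall x, m <= x <= z -> c * (x - m) ^ 2 <= u x <= K * (x - m) ^ 2 + d) ->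
  (1 <= n)%nat -> 2 / (c * INR n) <= z - m ->
  d * INR n ^ 2 <= 1 -> 4 * K * d * INR n ^ 2 <= 1 -> 2 * d * INR n <= z - m ->
  c * (z - m) ^ 2 / (4 * K / c ^ 2 + 1) * INR n ^ 2 <= Gamma f n.
Proof.
intros Cf Mf Ef Pu Pu' Hc HK Hd Hm Hz Hu Hn Hs D1 D2 D3.
destruct (well_escape (dfun f) u c K d m z n) as [x [Hx [Ex Ux]]]; auto; try lra.
assert (Px := Pu' x ltac:(lra)).
assert (Ix := diffeo_interior f x Mf ltac:(lra)); rewrite Ef in Ix.
assert (G := Gamma_ge_iter f n x (x + u x) ltac:(lra) ltac:(lra)).
rewrite <- Ef, iter_comm, Ex, Ef in G; rewrite Ef in G.
replace (z + u z - z) with (u z) in G by ring; replace (x + u x - x) with (u x) in G by ring.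
assert (Pz := Pu' z ltac:(lra)).
assert (Gp : 0 < Gamma f n) by nra.
assert (Hc2 : 0 < c ^ 2) by (apply pow_lt; lra).
assert (Q : 0 < 4 * K / c ^ 2 + 1).
{ assert (0 <= 4 * K / c ^ 2) by (apply Rmult_le_pos; [lra|apply Rlt_le, Rinv_0_lt_compat; auto]); lra. }
set (q := 4 * K / c ^ 2 + 1) in *.
apply Rmult_le_reg_r with q; auto.
replace (c * (z - m) ^ 2 / q * INR n ^ 2 * q) with (c * (z - m) ^ 2 * INR n ^ 2) by (field; lra).
specialize (Hu z ltac:(lra)).
assert (N2 := pow2_ge_0 (INR n)).
apply Rle_trans with (u z * INR n ^ 2); [apply Rmult_le_compat_r; lra|].
apply Rle_trans with (Gamma f n * (u x * INR n ^ 2)).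
- rewrite <- Rmult_assoc; apply Rmult_le_compat_r; auto.
- apply Rmult_le_compat_l; lra.
Qed.

(** * Choice of ranks and depths *)

Lemma bounded_below_rank (w : nat -> R) (N : nat) :
  exists b, 0 < b /\ forall n, (n < N)%nat -> w n <= b.
Proof.
induction N as [|N [b [Pb H]]]; [exists 1; split; [lra|lia]|].
exists (Rmax b (w N)); split; [apply Rlt_le_trans with (1 := Pb), Rmax_l|].
intros n Hn; destruct (Nat.eq_dec n N) as [->|E]; [apply Rmax_r|].
apply Rle_trans with (2 := Rmax_l _ _), H; lia.
Qed.

(** [N] need not be monotone: without such a [k], induction would keep every [N k] at or below [n],
    against [k <= N k]. *)
Lemma between_ranks (N : nat -> nat) (n : nat) :
  (forall k, (k <= N k)%nat) -> (N O <= n)%nat ->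
  exists k, (N k <= n < N (S k))%nat.
Proof.
intros H H0; destruct (classic (exists k, (N k <= n < N (S k))%nat)) as [|E]; auto.
exfalso; assert (A : forall k, (N k <= n)%nat).
{ induction k as [|k IH]; auto.
  destruct (Nat.le_gt_cases (N (S k)) n) as [|L]; auto; exfalso; apply E; now exists k. }
specialize (A (S n)); specialize (H (S n)); lia.
Qed.

Lemma small_depth (K T l : R) :
  0 <= K -> 0 <= T -> 0 < l ->
  exists d, 0 < d /\
    K * d * T ^ 2 <= 1 /\ 4 * K * (K * d) * T ^ 2 <= 1 /\ 2 * (K * d) * T <= l.
Proof.
intros HK HT Hl.
assert (X1 : 0 <= K * T ^ 2) by (apply Rmult_le_pos; auto; apply pow2_ge_0).
assert (X2 : 0 <= 4 * K * (K * T ^ 2)) by (apply Rmult_le_pos; lra).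
assert (X3 : 0 <= 2 * K * T) by (apply Rmult_le_pos; lra).
set (q := 1 + K * T ^ 2 + 4 * K * (K * T ^ 2) + 2 * K * T).
assert (Hq : 0 < q) by (unfold q; lra).
assert (Hm : 0 < Rmin 1 l) by (apply Rmin_pos; lra).
assert (Hd : 0 < Rmin 1 l / q) by (apply Rdiv_lt_0_compat; auto).
(* [q] dominates the coefficient of [d] in each of the three conditions. *)
exists (Rmin 1 l / q); set (d := Rmin 1 l / q) in *.
assert (E : d * q = Rmin 1 l) by (unfold d; field; lra).
assert (M1 := Rmin_l 1 l); assert (M2 := Rmin_r 1 l).
assert (Y : forall y, y <= q -> d * y <= Rmin 1 l).
{ intros y Hy; rewrite <- E; apply Rmult_le_compat_l; lra. }
assert (Y1 := Y (K * T ^ 2) ltac:(unfold q; lra)).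
assert (Y2 := Y (4 * K * (K * T ^ 2)) ltac:(unfold q; lra)).
assert (Y3 := Y (2 * K * T) ltac:(unfold q; lra)).
repeat split; lra || (apply Rle_trans with (Rmin 1 l); auto;
  match goal with |- ?x <= _ => ring_simplify x end; lra).
Qed.

(** The depth at index [j] must respect the requirement of every earlier well; starting from 1 keeps
    all depths at most 1. *)
Fixpoint running_min (d : nat -> R) (j : nat) : R :=
  match j with O => 1 | S j => Rmin (running_min d j) (d j) end.

Lemma running_min_bounds (d : nat -> R) (j : nat) :
  (forall k, 0 < d k) -> 0 < running_min d j <= 1.
Proof.
intros H; induction j as [|j IH]; simpl; [lra|]; split.
- apply Rmin_pos; auto; lra.
- apply Rle_trans with (1 := Rmin_l _ _); lra.
Qed.

Lemma running_min_le (d : nat -> R) (k j : nat) : (k < j)%nat -> running_min d j <= d k.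
Proof.
intros L; induction L; simpl; [apply Rmin_r|].
apply Rle_trans with (2 := IHL), Rmin_l.
Qed.

Lemma eventual_rank (eps : nat -> R) (a c l : R) (k : nat) :
  is_lim_seq eps 0 -> 0 < a -> 0 < c -> 0 < l ->
  exists N, (k <= N)%nat /\ (1 <= N)%nat /\
    forall n, (N <= n)%nat -> eps n <= a /\ 2 / (c * INR n) <= l.
Proof.
intros He Ha Hc Hl.
apply is_lim_seq_spec in He; destruct (He (mkposreal a Ha)) as [N1 H1]; simpl in H1.
assert (Hcl : 0 < c * l) by now apply Rmult_lt_0_compat.
destruct (nfloor_ex (2 / (c * l))) as [N2 H2].
{ apply Rlt_le, Rdiv_lt_0_compat; lra. }
exists (N1 + S N2 + k)%nat; split; [lia|split; [lia|]]; intros n Hn; split.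
- specialize (H1 n ltac:(lia)); rewrite Rminus_0_r in H1.
  apply Rle_trans with (1 := Rle_abs _); lra.
- assert (L : INR N2 + 1 <= INR n) by (rewrite <- S_INR; apply le_INR; lia).
  assert (P := pos_INR N2).
  assert (Q : 2 <= c * l * INR n).
  { apply Rle_trans with (c * l * (2 / (c * l))); [right; field; lra|].
    apply Rmult_le_compat_l; lra. }
  apply Rmult_le_reg_r with (c * INR n); [apply Rmult_lt_0_compat; lra|].
  replace (2 / (c * INR n) * (c * INR n)) with 2 by (field; lra); lra.
Qed.

Definition jid (n : nat) (x : R) : R := match n with O => x | 1%nat => 1 | _ => 0 end.

Lemma jid_add_scal_jet (V : nat -> R -> R) (r : R) :
  jet V -> jet (fun n x => jid n x + r * V n x).
Proof.
intros J n x; apply (is_derive_plus (jid n) (fun t => r * V n t)).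
- destruct n as [|[|n]].
  + apply (is_derive_id (K := R_AbsRing)).
  + apply (is_derive_const (K := R_AbsRing) (V := R_NormedModule)).
  + apply (is_derive_const (K := R_AbsRing) (V := R_NormedModule)).
- apply is_derive_scal, J.
Qed.

(** * Construction of the diffeomorphism *)

Theorem theorem2 :
  forall (eps M : nat -> R),
    (forall n : nat, (1 <= n)%nat -> 0 < eps n) ->
    is_lim_seq eps 0 ->
    (forall n : nat, (1 <= n)%nat -> 0 < M n) ->
    non_quasianalytic M ->
    log_increasing M ->
    log_convex M ->
    is_lim_seq M p_infty ->
    exists f : Diff01,
      Carleman M f /\
      eq_Dom (Efix f) (Efix_inf f) /\
      eq_Dom (Efix_inf f) (fun x => x = 0 \/ x = 1) /\
      (forall n : nat, (1 <= n)%nat -> Gamma f n >= eps n * INR n ^ 2).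
Proof.
intros eps M Peps Leps PM NQ HI HC _.
destruct (flat_function M PM HI NQ) as [G [A0 [c [JG [HA0 [Hc [BG [GZ [GP GM]]]]]]]]].
assert (FG : flat_at0 (G O) (G O 1)).
{ repeat split; auto. }
set (A := G O 1) in *; set (g := G O) in *.
destruct (prof_jet M G A0 c A PM HI HC JG HA0 Hc BG FG) as [B [c' [HB [Hc' HV]]]].
fold g in HV.
assert (PM1 := PM 1%nat (le_n _)).
(* [S] bounds the first derivative of the profile for every admissible choice of depths. *)
set (S := B * c' * M 1%nat + 1).
assert (HS : 1 <= S).
{ assert (0 <= B * c' * M 1%nat) by (repeat apply Rmult_le_pos; lra); unfold S; lra. }
(* [beta] is a depth-independent lower bound for the profile at [wend 0], and hence for its steepest
   descent before 1. *)
set (beta := wconst g 0 * (wend 0 - wmid 0) ^ 2).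
assert (Len : forall k, 0 < wend k - wmid k).
{ intros k; assert (P := rad_pos k); unfold wend, wmid; lra. }
assert (Hbeta : 0 < beta).
{ apply Rmult_lt_0_compat; [now apply wconst_pos with A|apply pow_lt, Len]. }
(* A priori bounds for the factor [r], which depends on the depths: it will be [(1 - t) / mu] with
   [t <= 1/2] and [beta <= mu <= S]. *)
set (k1 := / (2 * S)); set (k2 := / beta).
assert (Hk1 : 0 < k1) by (apply Rinv_0_lt_compat; lra).
assert (Hk2 : 0 < k2) by (apply Rinv_0_lt_compat; lra).
set (L := 1 + k2 * S); assert (HL : 1 <= L) by (unfold L; nra).
set (K := k2 * (2 * (A * A))).
assert (HK : 0 <= K) by (unfold K; assert (P := Rle_0_sqr A); unfold Rsqr in P; nra).
set (cc := fun k => Rmin 1 (k1 * wconst g k)).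
assert (Hcc : forall k, 0 < cc k <= 1).
{ intros k; split; [|apply Rmin_l]; apply Rmin_pos; [lra|].
  apply Rmult_lt_0_compat; auto; now apply wconst_pos with A. }
set (a := fun k => cc k * (wend k - wmid k) ^ 2 / (4 * K / cc k ^ 2 + 1)).
assert (Ha : forall k, 0 < a k).
{ intros k; specialize (Hcc k); assert (P2 : 0 < cc k ^ 2) by (apply pow_lt; lra).
  assert (0 <= 4 * K / cc k ^ 2) by (apply Rmult_le_pos; [lra|apply Rlt_le, Rinv_0_lt_compat; auto]).
  apply Rdiv_lt_0_compat; [|lra]; apply Rmult_lt_0_compat; [lra|apply pow_lt, Len]. }
(* There is no circularity: [a] and [cc] do not involve the depths, so the ranks [N] come first, and
   [d k] is then fitted to times up to the next rank. *)
destruct (functional_choice _ (fun k => eventual_rank eps (a k) (cc k) (wend k - wmid k) k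
  Leps (Ha k) (proj1 (Hcc k)) (Len k))) as [N HN].
destruct (functional_choice _ (fun k => small_depth K (INR (N (Datatypes.S k))) (wend k - wmid k)
  HK (pos_INR _) (Len k))) as [d Hd].
set (D := running_min d).
assert (HD : forall k, 0 < D k <= 1) by (intros k; apply running_min_bounds, Hd).
assert (HD' : forall k, 0 <= D k <= 1) by (intros k; specialize (HD k); lra).
destruct (HV D HD') as [V [JV [EV [ZV BV]]]].
assert (BV1 : forall x, Rabs (V 1%nat x) <= S).
{ intros x; apply Rle_trans with (1 := BV 1%nat x I); unfold S, weight; simpl; lra. }
destruct (continuity_ab_maj (fun x => - V 1%nat x) 0 1) as [p [Hp Ip]]; [lra| |].
{ intros x _; apply continuity_pt_opp, jet_continuity, JV. }
set (mu := - V 1%nat p) in *.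
(* The profile falls from at least [beta] at 3/4 to 0 at 1, so some slope in between is below
   [- beta]. *)
assert (Hmu : beta <= mu).
{ destruct (derive_mvt _ _ (wend 0) 1 (JV O)) as [s [Hs E]].
  assert (P0 : wend 0 = 3/4) by (unfold wend, rad; simpl; lra).
  assert (P1 : wmid 0 = 5/8) by (unfold wmid, rad; simpl; lra).
  rewrite Rmin_left, Rmax_right in Hs by lra.
  rewrite (ZV O 1), EV in E by lra.
  assert (Q := prof_lower g A (wend 0) D 0 FG HD' ltac:(lra)); fold beta in Q.
  specialize (Hp s ltac:(lra)); rewrite P0 in E, Q; lra. }
assert (HmuS : mu <= S) by (apply Rle_trans with (2 := BV1 p); rewrite <- Rabs_Ropp; apply Rle_abs).
assert (Hp' : forall x, - V 1%nat x <= mu).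
{ intros x; destruct (classic (I01 x)) as [Ix|Nx]; [now apply Hp|].
  rewrite ZV by (unfold I01 in Nx; lra); lra. }
assert (Hp01 : 0 < p < 1).
{ destruct (classic (p <= 0 \/ 1 <= p)) as [Q|Q]; [|lra].
  unfold mu in *; rewrite (ZV _ _ Q) in *; lra. }
destruct (bounded_below_rank (fun n => eps n * INR n ^ 2 * (2 * L ^ n)) (N O)) as [b [Hb Hbn]].
(* [t] will be the smallest value of the derivative; being at most [/ b], it settles all times below
   [N O] at once. *)
set (t := Rmin (/ 2) (/ b)).
assert (Ht : 0 < t) by (apply Rmin_pos; [lra|now apply Rinv_0_lt_compat]).
assert (Ht1 : t <= / 2) by apply Rmin_l.
assert (Ht2 : t * b <= 1).
{ apply Rle_trans with (/ b * b); [apply Rmult_le_compat_r; [lra|apply Rmin_r]|right; field; lra]. }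
(* With this factor the derivative at the steepest point [p] is [1 - r mu = t]. *)
set (r := (1 - t) / mu).
assert (Hr1 : k1 <= r).
{ apply Rle_trans with (/ 2 * / mu).
  - unfold k1; rewrite Rinv_mult; apply Rmult_le_compat_l; [lra|]; apply Rinv_le_contravar; lra.
  - apply Rmult_le_compat_r; [apply Rlt_le, Rinv_0_lt_compat|]; lra. }
assert (Hr2 : r <= k2).
{ apply Rle_trans with (1 * / mu).
  - apply Rmult_le_compat_r; [apply Rlt_le, Rinv_0_lt_compat|]; lra.
  - rewrite Rmult_1_l; apply Rinv_le_contravar; lra. }
assert (Hrmu : r * mu = 1 - t) by (unfold r; field; lra).
set (F := fun n x => jid n x + r * V n x).
assert (JF : jet F) by now apply jid_add_scal_jet.
assert (F1 : forall x, t <= F 1%nat x <= L).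
{ intros x; unfold F; simpl jid; specialize (Hp' x); split; [nra|].
  specialize (BV1 x); assert (Q := Rle_abs (V 1%nat x)); unfold L.
  assert (r * V 1%nat x <= r * S) by (apply Rmult_le_compat_l; lra).
  assert (r * S <= k2 * S) by (apply Rmult_le_compat_r; lra); lra. }
set (B2 := r * (B * c' ^ 2 * weight M 2)).
assert (F2 : forall x, Rabs (F 2%nat x) <= B2).
{ intros x; unfold F; simpl jid; rewrite Rplus_0_l, Rabs_mult, Rabs_right by lra.
  apply Rmult_le_compat_l; [lra|]; now apply BV. }
assert (F1p : F 1%nat p = t).
{ unfold F; simpl jid; replace (V 1%nat p) with (- mu) by (unfold mu; ring); lra. }
destruct (diffeo_of_jet F t B2 JF) as [f Ef]; auto; [|apply F1|].
{ intros x Hx; unfold F; simpl; rewrite ZV; auto; ring. }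
assert (Mf : forall x y, x < y -> dfun f x < dfun f y).
{ intros x y Hxy; rewrite Ef.
  assert (Q := jet_increment F L x y JF); destruct Q; auto; [|lra].
  intros s; specialize (F1 s); lra. }
set (u := fun x => r * V O x).
assert (Eu : forall x, dfun f x = x + u x) by (intros x; now rewrite Ef).
assert (Pu' : forall x, 0 < x < 1 -> 0 < u x).
{ intros x Hx; unfold u; rewrite EV; apply Rmult_lt_0_compat; [lra|]; now apply prof_pos with A. }
assert (Pu : forall x, 0 <= u x).
{ intros x; destruct (classic (0 < x < 1)) as [Q|Q]; [now apply Rlt_le, Pu'|].
  unfold u; rewrite ZV; lra. }
assert (Fix : forall x, Efix f x -> x = 0 \/ x = 1).
{ intros x [Ix E]; rewrite Eu in E.
  destruct (Req_dec x 0); auto; destruct (Req_dec x 1); auto.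
  unfold I01 in Ix; specialize (Pu' x ltac:(lra)); lra. }
assert (Der : forall n x, I01 x -> Derive01_n f n x = F n x).
{ intros n x Hx; apply jet_Derive01_n; auto; intros; now rewrite Ef. }
assert (Inf : forall x, x = 0 \/ x = 1 -> Efix_inf f x).
{ intros x Hx; assert (Ix : I01 x) by (unfold I01; lra).
  assert (Z : forall n, V n x = 0) by (intros n; apply ZV; lra).
  repeat split; try apply Ix.
  - rewrite Eu; unfold u; rewrite Z; ring.
  - rewrite Der by auto; unfold F; rewrite Z; simpl; ring.
  - intros [|[|j]] Hj; try lia; rewrite Der by auto; unfold F; rewrite Z; simpl; ring. }
exists f; split; [|split; [|split]].
- split; [apply dfun_smooth|].
  assert (Q1 : 0 <= / M 1%nat) by (apply Rlt_le, Rinv_0_lt_compat; auto).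
  assert (Q2 : 0 <= r * B) by (apply Rmult_le_pos; lra).
  (* The first summand pays for the jet of the identity and the second for the profile; the last
     gives [q >= 1], so that [q <= q^n] enters the geometric constant. *)
  set (q := / M 1%nat + r * B + 1).
  assert (Hq : 1 <= q) by (unfold q; lra).
  exists (q * c'); intros [|n] x Hn Hx; [lia|]; rewrite Der by auto; unfold F.
  assert (W : M 1%nat <= M (Datatypes.S n)).
  { apply (weight_mono M 1 (Datatypes.S n)); auto. }
  assert (P1 : 1 <= c' ^ Datatypes.S n) by now apply pow_R1_Rle.
  apply Rle_trans with (q * (c' ^ Datatypes.S n * M (Datatypes.S n))).
  + apply Rle_trans with (1 := Rabs_triang _ _).
    rewrite Rabs_mult, (Rabs_right r) by lra.
    assert (X1 : Rabs (jid (Datatypes.S n) x) <= / M 1%nat * (c' ^ Datatypes.S n * M (Datatypes.S n))).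
    { apply Rle_trans with 1.
      - destruct n; simpl; [rewrite Rabs_R1|rewrite Rabs_R0]; lra.
      - apply Rle_trans with (/ M 1%nat * (1 * M 1%nat)); [right; field; lra|].
        apply Rmult_le_compat_l; auto; apply Rmult_le_compat; lra. }
    assert (X2 : r * Rabs (V (Datatypes.S n) x) <= r * B * (c' ^ Datatypes.S n * M (Datatypes.S n))).
    { rewrite Rmult_assoc; apply Rmult_le_compat_l; [lra|].
      rewrite <- Rmult_assoc; now apply (BV (Datatypes.S n)). }
    assert (X3 : 0 <= c' ^ Datatypes.S n * M (Datatypes.S n)) by (apply Rmult_le_pos; lra).
    unfold q; lra.
  + rewrite Rpow_mult_distr, Rmult_assoc; apply Rmult_le_compat_r.
    * apply Rmult_le_pos; lra.
    * rewrite <- (pow_1 q) at 1; apply Rle_pow; auto; lia.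
- split; intros x Hx; [now apply Inf, Fix|apply Hx].
- split; intros x Hx; [apply Fix, Hx|now apply Inf].
- intros n Hn; apply Rle_ge.
  (* From [N O] on, the well whose ranks enclose [n] gives the growth; before that, the contraction
     at [p] does. *)
  destruct (Nat.le_gt_cases (N O) n) as [Hn0|Hn0].
  + destruct (between_ranks N n) as [k [Hk1' Hk2']]; auto; [apply HN|].
    destruct (HN k) as [_ [_ HNk]]; destruct (HNk n Hk1') as [E1 E2].
    apply Rle_trans with (a k * INR n ^ 2).
    { apply Rmult_le_compat_r; auto; apply pow2_ge_0. }
    destruct (Hd k) as [Pd [D1 [D2 D3]]].
    assert (Hnk : INR n <= INR (N (Datatypes.S k))) by (apply le_INR; lia).
    assert (Hn2 : INR n ^ 2 <= INR (N (Datatypes.S k)) ^ 2) by (apply pow_incr; split; auto; apply pos_INR).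
    assert (Pk := rad_pos k); assert (Pk1 := rad_le1 k).
    assert (PKd : 0 <= K * d k) by (apply Rmult_le_pos; lra).
    apply Gamma_ge_well with (u := u) (d := K * d k); auto.
    * rewrite Ef; now apply jet_continuity.
    * unfold wmid; lra.
    * unfold wmid, wend; lra.
    * intros x Hx; unfold u; rewrite EV; split.
      -- apply Rle_trans with (k1 * wconst g k * (x - wmid k) ^ 2).
         { apply Rmult_le_compat_r; [apply pow2_ge_0|apply Rmin_r]. }
         assert (Q := prof_lower g A x D k FG HD' Hx).
         rewrite Rmult_assoc; apply Rmult_le_compat; auto; try lra.
         apply Rmult_le_pos; [now apply Rlt_le, wconst_pos with A|apply pow2_ge_0].
      -- apply Rle_trans with (k2 * (2 * (A * A * ((x - wmid k) ^ 2 + d k)))).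
         ++ apply Rmult_le_compat; try lra.
            ** apply Rmult_le_reg_l with r; [lra|]; rewrite Rmult_0_r, <- EV; apply Pu.
            ** apply prof_upper; auto; [lra|]; intros j Hj; now apply running_min_le.
         ++ unfold K; right; ring.
    * apply Rle_trans with (2 := D1), Rmult_le_compat_l; auto.
    * apply Rle_trans with (2 := D2), Rmult_le_compat_l; auto; apply Rmult_le_pos; lra.
    * apply Rle_trans with (2 := D3), Rmult_le_compat_l; auto; lra.
  + assert (Q := Gamma_ge_contraction f F B2 L p n JF Ef).
    rewrite F1p in Q.
    assert (Q' : 1 <= Gamma f n * (2 * t * L ^ n)).
    { apply Q; auto; intros x; specialize (F1 x); lra. }
    assert (PL : 0 < L ^ n) by (apply pow_lt; lra).
    specialize (Hbn n Hn0); cbv beta in Hbn.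
    assert (PtL : 0 < 2 * t * L ^ n) by (repeat apply Rmult_lt_0_compat; lra).
    apply Rmult_le_reg_r with (1 := PtL).
    apply Rle_trans with (2 := Q').
    apply Rle_trans with (2 := Ht2).
    apply Rle_trans with (t * (eps n * INR n ^ 2 * (2 * L ^ n))); [right; ring|].
    apply Rmult_le_compat_l; lra.
Qed.
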